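(* Let $\alpha>0$, $\rho>0$, $s\in(0,1]$, $0\le u<v$, and let $q>1$ and $p$ satisfy $\frac1p+\frac1q=1$. Let $\psi:[u^{\rho},v^{\rho}]\subset\mathbb{R}_{+}\to\mathbb{R}^{\alpha}$ be a differentiable function on $(u^{\rho},v^{\rho})$ with $\psi'\in L_1[u^{\rho},v^{\rho}]$. If $|\psi'|^{q}$ is generalized $s$-convex on $[u^{\rho},v^{\rho}]$, then $$\left|\frac{\psi(u^{\rho})+\psi(v^{\rho})}{2}-\frac{\rho^{\alpha}\Gamma(\alpha+1)}{2(v^{\rho}-u^{\rho})^{\alpha}}\left[{}^{\rho}I_{u^+}^{\alpha}\psi(v^{\rho})+{}^{\rho}I_{v^-}^{\alpha}\psi(u^{\rho})\right]\right|\le\frac{\rho(v^{\rho}-u^{\rho})}{2}\left(\frac{1}{p(\rho-1)+1}\right)^{\frac1p}\left[\frac{\beta_{\rho}(\alpha s+1,\alpha+1)}{\rho}+\frac{1}{\rho(\alpha s+\alpha+1)}\right]^{\frac1q}\left(|\psi'(u^{\rho})|^{q}+|\psi'(v^{\rho})|^{q}\right)^{\frac1q}.$$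
   Context: $\mathbb{R}_+=[0,\infty)$. Values in $\mathbb{R}^{\alpha}$ are treated as ordinary real numbers, and $\psi'$ is the ordinary derivative; $\psi'$ at the endpoints of the interval is understood as the one-sided derivative. A function $f$ on an interval $J\subset\mathbb{R}_+$ is generalized $s$-convex (in the second sense, with parameter $\alpha$) if $f(tx+(1-t)y)\le t^{\alpha s}f(x)+(1-t)^{\alpha s}f(y)$ for all $x,y\in J$ and $t\in[0,1]$. Katugampola fractional integrals, with the convention that $\psi(v^\rho)$, $\psi(u^{\rho})$ indicate the integral of $t\mapsto\psi(t^{\rho})$ evaluated at $v$, respectively $u$: $${}^{\rho}I_{u^+}^{\alpha}\psi(v^{\rho})=\frac{\rho^{1-\alpha}}{\Gamma(\alpha)}\int_u^v (v^{\rho}-t^{\rho})^{\alpha-1}t^{\rho-1}\psi(t^{\rho})\,dt,\qquad {}^{\rho}I_{v^-}^{\alpha}\psi(u^{\rho})=\frac{\rho^{1-\alpha}}{\Gamma(\alpha)}\int_u^v (t^{\rho}-u^{\rho})^{\alpha-1}t^{\rho-1}\psi(t^{\rho})\,dt.$$ The generalized beta function is $\beta_{\rho}(a,b)=\int_0^1\rho(1-x^{\rho})^{b-1}(x^{\rho})^{a-1}x^{\rho-1}\,dx$.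
   Formalization: The formal theorem adds the condition p(ρ−1)+1 > 0 (i.e. ρ > 1/q); for smaller ρ the factor (1/(p(ρ−1)+1))^{1/p} is undefined (division by zero or a fractional power of a negative number). *)

(* Defs.v *)
From mathcomp Require Import all_boot all_order all_algebra.
From mathcomp Require Import all_classical all_reals all_analysis.

Set Implicit Arguments.
Unset Strict Implicit.
Unset Printing Implicit Defensive.

Import Order.TTheory GRing.Theory Num.Theory.
Import numFieldNormedType.Exports.

Local Open Scope classical_set_scope.
Local Open Scope ring_scope.

Section Defs.
Context {R : realType}.
Implicit Types (rho alpha s x a b u v t : R) (f psi : R -> R).

Local Notation mu := (@lebesgue_measure R).

Definition Gamma x : R :=
  \int[mu]_(t in `[0, +oo[) (t `^ (x - 1) * expR (- t)).

Definition beta_rho rho a b : R :=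
  \int[mu]_(x in `[0, 1])
    (rho * (1 - x `^ rho) `^ (b - 1) * (x `^ rho) `^ (a - 1) * x `^ (rho - 1)).

(* Left-sided Katugampola integral of [f] based at [u], evaluated at [x].  The
   expression written rho-I_{u+}^alpha psi (v^rho) is
   [katugampola_left rho alpha u (fun t => psi (t `^ rho)) v]: the composite
   t |-> psi (t^rho) is integrated over [u, v], not [psi] up to v^rho. *)
Definition katugampola_left rho alpha u f x : R :=
  rho `^ (1 - alpha) / Gamma alpha *
  \int[mu]_(t in `[u, x])
    ((x `^ rho - t `^ rho) `^ (alpha - 1) * t `^ (rho - 1) * f t).

Definition katugampola_right rho alpha v f x : R :=
  rho `^ (1 - alpha) / Gamma alpha *
  \int[mu]_(t in `[x, v])
    ((t `^ rho - x `^ rho) `^ (alpha - 1) * t `^ (rho - 1) * f t).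

Definition gen_s_convex alpha s (J : set R) f : Prop :=
  forall x y t, J x -> J y -> 0 <= t <= 1 ->
    f (t * x + (1 - t) * y) <=
      t `^ (alpha * s) * f x + (1 - t) `^ (alpha * s) * f y.

Definition diff_quotient f x : R -> R := fun h => h^-1 * (f (x + h) - f x).

Definition derivable_cc a b f : Prop :=
  [/\ forall x, x \in `]a, b[ -> derivable f x 1,
      cvg (diff_quotient f a h @[h --> 0^'+]) &
      cvg (diff_quotient f b h @[h --> 0^'-])].

(* The derivative of [f] as a function on [a, b]: one-sided at the two
   endpoints, so that values of [f] outside [a, b] are irrelevant. *)
Definition derive_cc a b f x : R :=
  if x == a then lim (diff_quotient f a h @[h --> 0^'+])
  else if x == b then lim (diff_quotient f b h @[h --> 0^'-])
  else derive1 f x.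

End Defs.

(* Main.v *)
Require Import Defs.
From mathcomp Require Import all_boot all_order all_algebra.
From mathcomp Require Import all_classical all_reals all_analysis.
From mathcomp Require Import measurable_realfun ring lra.

Import Order.TTheory GRing.Theory Num.Theory.
Import numFieldNormedType.Exports.

Local Open Scope classical_set_scope.
Local Open Scope ring_scope.

(** Put [a = u `^ rho], [b = v `^ rho] and [phi y = psi (a + (b - a) * y)]. The
    substitution [y = (t `^ rho - a) / (b - a)] and its mirror image rewrite the
    quantity to be bounded as one half of
    [phi 0 + phi 1 - alpha * \int_0^1 y `^ (alpha - 1) * (phi y + phi (1 - y))]
    ([katugampola_trapezoid]). Only the function [S y = phi y + phi (1 - y)]
    enters. It is symmetric about [1 / 2], so the integral folds onto
    [[0, 1 / 2]] and only the size of the derivative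
    [phi' y - phi' (1 - y)] of [S] for [y < 1 / 2] matters
    ([trapezoid_defect_le]).

    Applying Hoelder's inequality directly to [phi'] gives the theorem for
    [rho <= 1] but not in general: since the ratio [rho / (p * (rho - 1) + 1)]
    decreases to [1 / p] as [rho] grows, the claim is stronger for large [rho].
    The gain comes from the cancellation in [phi' y - phi' (1 - y)]. Either
    the two values have the same sign, and only the larger one counts, or
    the derivative vanishes somewhere in between, and then convexity with
    respect to that zero improves both bounds ([darboux], [derivative_gap_le]).
    In both cases, with [sigma = alpha * s] and up to the factor [b - a],
    [`|phi' y - phi' (1 - y)|] is at most
    [2 `^ p^-1 * (`|psi' a| `^ q + `|psi' b| `^ q) `^ q^-1
      * (1 - y) `^ (sigma / q)].
    Young's inequality and two explicit moments of the kernel turn this into a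
    closed bound ([trapezoid_defect_power_le]).

    It remains to compare constants. For [sigma <= 1] the beta integral is at
    least [1 / ((alpha + 1) * (alpha + sigma + 1))] ([le_beta_rho]), and after
    this step everything follows from an inequality in [alpha] and [p] alone,
    [p * ((alpha + 1) / (alpha + 2)) `^ (p - 1)
      * (2 * (1 - 2 `^ (- alpha)) / (alpha + 1)) <= 1]
    ([weight_constant_le], [constant_le]). For [sigma > 1] a nonnegative
    generalized convex function vanishes identically, and both sides are [0].

    All functions to be integrated have explicit primitives, or are compared with
    functions that have one; integrals therefore occur through increments of
    primitives, which may have unbounded derivatives at the endpoints
    ([primitive_on], [le_increment]). *)

Set Implicit Arguments.
Unset Strict Implicit.

(** * Primitives and singular integrals *)

(** The derivative is asked for only inside the interval, so that a power
    [t `^ (alpha - 1)] with [0 < alpha < 1], unbounded at [0], still has a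
    primitive on [[0, b]]. *)
Definition primitive_on (R : realType) (a b : R) (F f : R -> R) : Prop :=
  {within `[a, b], continuous F} /\ forall x, a < x < b -> is_derive x 1 F (f x).

Section primitive_on_calculus.
Context {R : realType}.
Implicit Types (a b c x : R) (F G f g h : R -> R).

Lemma primitive_on_cst a b c : primitive_on a b (fun=> c) (fun=> 0).
Proof.
split; first by move=> x; exact: cvg_cst.
by move=> x _; exact: is_derive_cst.
Qed.

Lemma primitive_on_id a b : primitive_on a b (fun x => x) (fun=> 1).
Proof.
split; first by apply: continuous_subspaceT => x; exact: cvg_id.
by move=> x _; exact: is_derive_id.
Qed.

Lemma primitive_onD a b F f G g :
  primitive_on a b F f -> primitive_on a b G g ->
  primitive_on a b (fun x => F x + G x) (fun x => f x + g x).
Proof.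
move=> [cF dF] [cG dG]; split.
  by move=> x; apply: cvgD; [exact: cF|exact: cG].
by move=> x axb; exact: (is_deriveD (dF _ axb) (dG _ axb)).
Qed.

Lemma primitive_onN a b F f :
  primitive_on a b F f -> primitive_on a b (fun x => - F x) (fun x => - f x).
Proof.
move=> [cF dF]; split; first by move=> x; apply: cvgN; exact: cF.
by move=> x axb; exact: (is_deriveN (dF _ axb)).
Qed.

Lemma primitive_onB a b F f G g :
  primitive_on a b F f -> primitive_on a b G g ->
  primitive_on a b (fun x => F x - G x) (fun x => f x - g x).
Proof. by move=> pF pG; apply: primitive_onD pF (primitive_onN pG). Qed.

Lemma primitive_onM a b F f G g :
  primitive_on a b F f -> primitive_on a b G g ->
  primitive_on a b (fun x => F x * G x) (fun x => F x * g x + G x * f x).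
Proof.
move=> [cF dF] [cG dG]; split.
  by move=> x; apply: cvgM; [exact: cF|exact: cG].
by move=> x axb; exact: (is_deriveM (dF _ axb) (dG _ axb)).
Qed.

Lemma primitive_onZ a b c F f :
  primitive_on a b F f ->
  primitive_on a b (fun x => c * F x) (fun x => c * f x).
Proof.
move=> [cF dF]; split.
  by move=> x; apply: cvgM; [exact: cvg_cst|exact: cF].
by move=> x axb; exact: (is_deriveZ _ (dF _ axb)).
Qed.

Lemma primitive_on_eq a b F f g :
  (forall x, a < x < b -> f x = g x) ->
  primitive_on a b F f -> primitive_on a b F g.
Proof. by move=> fg [cF dF]; split => // x axb; rewrite -fg//; exact: dF. Qed.

Lemma primitive_on_sub a b a' b' F f : a' <= a -> b <= b' ->
  primitive_on a' b' F f -> primitive_on a b F f.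
Proof.
move=> aa bb [cF dF]; split.
  by apply: continuous_subspaceW cF; apply: subset_itv; rewrite bnd_simp.
move=> x /andP[ax xb]; apply: dF.
by rewrite (le_lt_trans aa ax) (lt_le_trans xb bb).
Qed.

(** Relative continuity is needed because [powR] is not continuous at [0]: it
    takes the value [1] at every negative base. *)
Lemma within_continuous_comp (A B : set R) F h :
  (forall x, A x -> B (h x)) ->
  {within B, continuous F} -> {within A, continuous h} ->
  {within A, continuous (F \o h)}.
Proof.
move=> AB /subspace_continuousP cF /subspace_continuousP ch.
apply/subspace_continuousP => x Ax.
apply: (cvg_comp _ _ _ (cF _ (AB _ Ax))).
move=> U /= [V nV VU]; have /= := ch _ Ax _ (ex_intro2 _ _ V nV (fun=> id)).
rewrite /within/= !nbhs_simpl/=; apply: filterS => y Vy Ay.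
by apply: VU; [exact: Vy|exact: AB].
Qed.

Lemma primitive_on_comp a b c d F f h g :
  (forall x, a <= x <= b -> c <= h x <= d) ->
  (forall x, a < x < b -> c < h x < d) ->
  primitive_on c d F f -> primitive_on a b h g ->
  primitive_on a b (fun x => F (h x)) (fun x => f (h x) * g x).
Proof.
move=> hcc hoo [cF dF] [ch dh]; split.
  apply: within_continuous_comp cF ch => x /=; rewrite !in_itv/=.
  exact: hcc.
move=> x axb; exact: (is_derive1_comp (dF _ (hoo _ axb)) (dh _ axb)).
Qed.

Lemma powR_continuous_within (A : set R) e : 0 < e -> (forall x, A x -> 0 <= x) ->
  {within A, continuous (fun x => x `^ e)}.
Proof.
move=> e0 A0; apply: (@subspace_eq_continuous _ _ _ (fun x => `|x| `^ e)).
  by move=> x /[!inE] Ax; rewrite /= ger0_norm// A0.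
apply: continuous_subspaceT => x.
have [->|x0] := eqVneq x 0.
  apply/cvgrPdist_lt => /= eps eps0; near=> t.
  rewrite normr0 powR0 ?gt_eqF// sub0r normrN ger0_norm ?powR_ge0//.
  rewrite -[eps]powRr1 ?(ltW eps0)// -[X in _ < _ `^ X](mulVf (lt0r_neq0 e0)) powRrM.
  apply: gt0_ltr_powR => //; rewrite ?nnegrE ?powR_ge0//.
  near: t; apply: (@cvgr0_norm_lt _ _ _ (nbhs (0 : R)) _ id); first exact: cvg_id.
  by rewrite powR_gt0.
apply: (@continuous_comp _ _ _ (@Num.norm _ R) (@powR _ ^~ e)); first exact: norm_continuous.
apply: differentiable_continuous; apply/derivable1_diffP.
by apply: derivable_powR; rewrite in_itv/= andbT normr_gt0.
Unshelve. all: by end_near. Qed.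

Lemma primitive_on_powR a b e : 0 <= a -> 0 < e ->
  primitive_on a b (fun x => x `^ e) (fun x => e * x `^ (e - 1)).
Proof.
move=> a0 e0; split.
  apply: powR_continuous_within => // x; rewrite /= in_itv/= => /andP[ax _].
  exact: le_trans ax.
by move=> x /andP[ax _]; apply: is_derive1_powR; exact: le_lt_trans ax.
Qed.

Lemma primitive_on_expRN a b :
  primitive_on a b (fun x : R => expR (- x)) (fun x => - expR (- x)).
Proof.
split; last by move=> x _; apply: is_derive_eq; rewrite ?scaler1//mulrN1.
apply: continuous_subspaceT => x.
by apply: continuous_comp; [exact: continuousN|exact: continuous_expR].
Qed.

Lemma primitive_on_continuous a b F f x : primitive_on a b F f ->
  a < x < b -> {for x, continuous F}.
Proof.
move=> [_ dF] axb; apply: differentiable_continuous; apply/derivable1_diffP.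
exact: (@ex_derive _ _ _ _ _ _ _ (dF _ axb)).
Qed.

(** The mean value inequality. It carries every comparison of integrals below:
    two integrals are compared through primitives of their integrands. *)
Lemma le_increment a b F G f g : a <= b ->
  primitive_on a b F f -> primitive_on a b G g ->
  (forall x, a < x < b -> f x <= g x) ->
  F b - F a <= G b - G a.
Proof.
move=> ab pF pG fg; have [cH dH] := primitive_onB pG pF.
have [<-|ab'] := eqVneq a b; first by rewrite !subrr.
have ltab : a < b by rewrite lt_neqAle ab' ab.
have dH' x : x \in `]a, b[ -> is_derive x 1 (fun x => G x - F x) (g x - f x).
  by rewrite in_itv/=; exact: dH.
have [c + /= E] := MVT ltab dH' cH.
rewrite in_itv/= => acb.
have : 0 <= (g c - f c) * (b - a) by rewrite mulr_ge0 ?subr_ge0// fg.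
rewrite -E; lra.
Qed.

Lemma norm_le_increment a b F G f g : a <= b ->
  primitive_on a b F f -> primitive_on a b G g ->
  (forall x, a < x < b -> `|f x| <= g x) ->
  `|F b - F a| <= G b - G a.
Proof.
move=> ab pF pG fg; rewrite ler_norml; apply/andP; split; last first.
  apply: (@le_increment _ _ F G f g) => // x /fg.
  by rewrite ler_norml => /andP[].
have : - F b - (- F a) <= G b - G a; last by lra.
apply: (@le_increment _ _ (fun x => - F x) G (fun x => - f x) g) => //.
  exact: primitive_onN.
by move=> x /fg; rewrite ler_norml => /andP[? _]; lra.
Qed.

Local Notation mu := (@lebesgue_measure R).

Lemma primitive_on_Rintegral a b f : a <= b ->
  mu.-integrable `[a, b] (EFin \o f) ->
  (forall x, a < x < b -> {for x, continuous f}) ->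
  primitive_on a b (fun x => \int[mu]_(t in `[a, x]) f t) f.
Proof.
move=> ab intf cf; split.
  exact: parameterized_integral_continuous ab intf.
move=> x axb; have /andP[ax xb] := axb.
have [d e] := continuous_FTC1_closed xb intf ax (cf _ axb).
by rewrite -e derive1E; exact/derivableP.
Qed.

Lemma Rintegral_primitive a b F f : a <= b ->
  mu.-integrable `[a, b] (EFin \o f) ->
  (forall x, a < x < b -> {for x, continuous f}) ->
  primitive_on a b F f ->
  \int[mu]_(t in `[a, b]) f t = F b - F a.
Proof.
move=> ab intf cf pF; have pP := primitive_on_Rintegral ab intf cf.
have := le_increment ab pP pF (fun _ _ => lexx _).
have := le_increment ab pF pP (fun _ _ => lexx _).
by rewrite set_itv1 Rintegral_set1 subr0 => ? ?; apply/le_anti/andP.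
Qed.

Lemma le_primitive_Rintegral a b F f g : a <= b ->
  mu.-integrable `[a, b] (EFin \o g) ->
  (forall x, a < x < b -> {for x, continuous g}) ->
  primitive_on a b F f -> (forall x, a < x < b -> f x <= g x) ->
  F b - F a <= \int[mu]_(t in `[a, b]) g t.
Proof.
move=> ab intg cg pF fg; have pP := primitive_on_Rintegral ab intg cg.
have := le_increment ab pF pP fg.
by rewrite set_itv1 Rintegral_set1 subr0.
Qed.

Lemma le_Rintegral_primitive a b F f g : a <= b ->
  mu.-integrable `[a, b] (EFin \o f) ->
  (forall x, a < x < b -> {for x, continuous f}) ->
  primitive_on a b F g -> (forall x, a < x < b -> f x <= g x) ->
  \int[mu]_(t in `[a, b]) f t <= F b - F a.
Proof.
move=> ab intf cf pF fg; have pP := primitive_on_Rintegral ab intf cf.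
have := le_increment ab pP pF fg.
by rewrite set_itv1 Rintegral_set1 subr0.
Qed.

(** If [`|f| <= G'] then the integral of [`|f|] over each segment is at most an
    increment of [G]; a uniform bound on the increments passes to the union by
    monotone convergence. *)
Lemma integrable_exhaust f G g (c d : nat -> R) (C : R) :
  (forall n, c n <= d n) ->
  (forall n m, (n <= m)%N -> c m <= c n /\ d n <= d m) ->
  (forall n, {within `[c n, d n], continuous f}) ->
  (forall n, primitive_on (c n) (d n) G g) ->
  (forall n x, c n < x < d n -> `|f x| <= g x) ->
  (forall n, G (d n) - G (c n) <= C) ->
  mu.-integrable (\bigcup_n `[c n, d n]%classic) (EFin \o f).
Proof.
move=> cd nest cf pG fg GC.
have mf n : measurable_fun `[c n, d n] f.
  apply/measurable_EFinP; apply: (measurable_int mu).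
  by apply: continuous_compact_integrable => //; exact: segment_compact.
have mfU : measurable_fun (\bigcup_n `[c n, d n]%classic) f.
  by apply/measurable_fun_bigcup.
apply/integrableP; split; first exact/measurable_EFinP.
have H : (\int[mu]_(x in `[c i, d i]) `|(EFin \o f) x|)%E @[i --> \oo] -->
  (\int[mu]_(x in (\bigcup_n `[c n, d n]%classic)) `|(EFin \o f) x|)%E.
  apply: ge0_nondecreasing_set_cvg_integral => //.
  - move=> n m nm; have [cmn dnm] := nest _ _ nm.
    rewrite subsetEset; apply: subset_itv; rewrite bnd_simp.
      exact: cmn.
    exact: dnm.
  - move=> n; apply: measurableT_comp => //; apply/measurable_EFinP; exact: mf.
apply: (@le_lt_trans _ _ C%:E); last by rewrite ltry.
rewrite -(cvg_lim _ H)//; apply: lime_le; first by apply/cvg_ex; eexists; exact: H.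
apply: nearW => n.
have cabs : {within `[c n, d n], continuous (fun x => `|f x|)}.
  by move=> x; apply: cvg_norm; exact: cf.
have iabs : mu.-integrable `[c n, d n] (EFin \o (fun x => `|f x|)).
  by apply: continuous_compact_integrable => //; exact: segment_compact.
have : \int[mu]_(x in `[c n, d n]) `|f x| <= G (d n) - G (c n).
  apply: (@le_Rintegral_primitive _ _ G (fun x => `|f x|) g) => // x cxd; last exact: fg cxd.
  apply: (@within_continuous_continuous _ _ _ (c n) (d n)) => //.
    by case/andP: cxd => /lt_trans cx /cx.
move=> /le_trans /(_ (GC n)); rewrite -lee_fin /Rintegral fineK//.
exact: integrable_fin_num.
Qed.

Lemma bigcup_itvcc_oo a b : a < b ->
  \bigcup_n `[a + (b - a) / n.+2%:R, b - (b - a) / n.+2%:R]%classic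
  = `]a, b[%classic.
Proof.
move=> ab; have ba : 0 < b - a by rewrite subr_gt0.
apply/seteqP; split => x /=.
  move=> [n _ /=]; rewrite !in_itv/= => /andP[ax xb].
  have : 0 < (b - a) / n.+2%:R by rewrite divr_gt0.
  by move: (_ / _) ax xb => e ? ? ?; apply/andP; split; lra.
rewrite in_itv/= => /andP[ax xb].
set e := Num.min (x - a) (b - x).
have e0 : 0 < e by rewrite lt_min !subr_gt0 ax.
pose n := Num.truncn ((b - a) / e).
have ne : (b - a) / n.+2%:R <= e.
  rewrite ler_pdivrMr// mulrC -ler_pdivrMr//.
  have /truncn_itv/andP[_ /ltW /le_trans] : 0 <= (b - a) / e by rewrite divr_ge0// ltW.
  by apply; rewrite ler_nat.
exists n => //=; rewrite in_itv/=.
move: ne; rewrite le_min; move: (_ / _) => d /andP[? ?].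
by apply/andP; split; lra.
Qed.

(** The integrability test for singular integrands: the values of [f] at the
    endpoints do not matter, and near them [f] is controlled by the derivative
    of a function that is continuous up to the endpoints. *)
Lemma integrable_dominated_by_derivative a b f G g : a < b ->
  (forall x, a < x < b -> {for x, continuous f}) ->
  primitive_on a b G g ->
  (forall x, a < x < b -> `|f x| <= g x) ->
  mu.-integrable `[a, b] (EFin \o f).
Proof.
move=> ab cf pG fg; have ba : 0 < b - a by rewrite subr_gt0.
pose e n := (b - a) / (n.+2%:R : R).
have e0 n : 0 < e n by rewrite divr_gt0.
have e2 n : e n <= (b - a) / 2 by rewrite ler_pM2l// lef_pV2 ?posrE// ler_nat.
have inab n x : a + e n <= x <= b - e n -> a < x < b.
  by move=> /andP[? ?]; have := e0 n; move=> ?; apply/andP; split; lra.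
suff int_oo : mu.-integrable `]a, b[ (EFin \o f).
  have mf : measurable_fun `]a, b[ (EFin \o f) by exact: (measurable_int mu).
  apply/integrableP; split.
    apply/measurable_EFinP.
    apply/measurable_fun_itv_bndo_bndcP/measurable_fun_itv_obnd_cbndP.
    exact/measurable_EFinP.
  rewrite integral_itv_bndoo; first by case/integrableP: int_oo.
  exact: measurableT_comp mf.
rewrite -bigcup_itvcc_oo//.
apply: (@integrable_exhaust f G g _ _ (G b - G a)).
- by move=> n; have := e2 n; have := e0 n; rewrite /e; move: (_ / n.+2%:R) => d ? ?; lra.
- move=> n m nm; have : e m <= e n by rewrite ler_pM2l// lef_pV2 ?posrE// ler_nat.
  by rewrite /e; move: (_ / n.+2%:R) (_ / m.+2%:R) => ? ? ?; split; lra.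
- move=> n; apply: continuous_in_subspaceT => x; rewrite inE/= in_itv/=.
  by move=> /inab; exact: cf.
- move=> n; apply: primitive_on_sub pG.
    by have := e0 n; rewrite /e; move: (_ / _) => ? ?; lra.
  by have := e0 n; rewrite /e; move: (_ / _) => ? ?; lra.
- by move=> n x /andP[/ltW ? /ltW ?]; apply/fg/(inab n)/andP.
- move=> n; have mono x y : a <= x -> x <= y -> y <= b -> G x <= G y.
    move=> ax xy yb; have := @le_increment x y (fun=> 0) G (fun=> 0) g xy
      (primitive_on_cst _ _ _) (primitive_on_sub ax yb pG).
    rewrite subrr subr_ge0; apply => z /andP[xz zy].
    apply: le_trans (fg z _); first exact: normr_ge0.
    by rewrite (le_lt_trans ax xz) (lt_le_trans zy yb).
  have := e0 n; have := e2 n; rewrite /e /=; move: (_ / n.+2%:R) => d ? ?.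
  by apply: lerB; apply: mono; lra.
Qed.

End primitive_on_calculus.

(** * The Gamma function *)

Section gamma.
Context {R : realType}.
Implicit Types (a x t : R).
Local Notation mu := (@lebesgue_measure R).

Lemma powR_continuous_pos a x : 0 < x -> {for x, continuous (fun t => t `^ a)}.
Proof.
move=> x0; apply: differentiable_continuous; apply/derivable1_diffP.
by apply: derivable_powR; rewrite in_itv/= andbT.
Qed.

(** This is [x / a <= expR (x / a)] raised to the power [a]. *)
Lemma powR_le_expR a x : 0 < a -> 0 <= x -> x `^ a <= a `^ a * expR x.
Proof.
move=> a0 x0; have xa0 : 0 <= x / a by rewrite divr_ge0// ltW.
have -> : x = a * (x / a) by rewrite mulrC divfK// gt_eqF.
rewrite powRM ?(ltW a0)//; apply: ler_wpM2l; first exact: powR_ge0.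
rewrite [a * _]mulrC expRM; apply: ge0_ler_powR; rewrite ?nnegrE ?expR_ge0 ?(ltW a0)//.
by apply: le_trans (expR_ge1Dx _); rewrite lerDr.
Qed.

Let integrand a t := t `^ (a - 1) * expR (- t).

Let integrand_ge0 a t : 0 <= integrand a t.
Proof. by rewrite mulr_ge0 ?powR_ge0 ?expR_ge0. Qed.

Let integrand_continuous a t : 0 < t -> {for t, continuous (integrand a)}.
Proof.
move=> t0; apply: cvgM; first exact: powR_continuous_pos.
by apply: continuous_comp; [exact: continuousN|exact: continuous_expR].
Qed.

Lemma integrable_gamma_integrand a : 0 < a ->
  mu.-integrable `[0, +oo[ (EFin \o (fun t => t `^ (a - 1) * expR (- t))).
Proof.
move=> a0.
pose C : R := 2 * (1 + (a + a) `^ (a + a)) / a.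
have C0 : 0 <= C by rewrite divr_ge0 ?mulr_ge0 ?addr_ge0 ?powR_ge0 ?(ltW a0).
(* The bounded function C t^a / (1 + t^a) has a derivative that dominates the
   integrand on the whole half-line *)
pose G t : R := C * (1 - (1 + t `^ a)^-1).
pose g t : R := C * (- (- (1 + t `^ a) ^- 2 * (0 + a * t `^ (a - 1)))).
suff int_oo : mu.-integrable `]0, +oo[ (EFin \o integrand a).
  have mf := measurable_int mu int_oo.
  apply/integrableP; split.
    apply/measurable_EFinP/measurable_fun_itv_obnd_cbndP.
    exact/measurable_EFinP.
  rewrite -integral_itv_obnd_cbnd; first by case/integrableP: int_oo.
  exact: measurableT_comp mf.
have pos n t : (n.+1%:R : R)^-1 <= t -> 0 < t.
  by apply: lt_le_trans; rewrite invr_gt0.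
have -> : `]0 : R, +oo[%classic = \bigcup_n `[(n.+1%:R)^-1 : R, n.+1%:R]%classic.
  apply/seteqP; split => t /=; last first.
    by move=> [n _ /=]; rewrite !in_itv/= andbT => /andP[/pos].
  rewrite in_itv/= andbT => t0; exists (Num.truncn (t + t^-1)) => //=.
  have /truncn_itv/andP[_ /ltW le1] : 0 <= t + t^-1 by rewrite addr_ge0 ?invr_ge0 ?(ltW t0).
  rewrite in_itv/=; apply/andP; split.
    rewrite invf_ple ?posrE//; apply: le_trans le1.
    by rewrite lerDr ltW.
  by apply: le_trans le1; rewrite lerDl invr_ge0 ltW.
apply: (@integrable_exhaust _ (integrand a) G g _ _ C).
- move=> n; apply: (@le_trans _ _ 1); last by rewrite ler1n.
  by rewrite invf_le1// ler1n.
- move=> n m nm; rewrite lef_pV2 ?posrE// !ler_nat !ltnS; by split.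
- move=> n; apply: continuous_in_subspaceT => t; rewrite inE/= in_itv/=.
  by move=> /andP[/pos t0 _]; exact: integrand_continuous.
- move=> n; apply: primitive_onZ.
  have pS : primitive_on (n.+1%:R^-1) n.+1%:R (fun t : R => 1 + t `^ a)
      (fun t => 0 + a * t `^ (a - 1)).
    apply: primitive_onD; first exact: primitive_on_cst.
    by apply: primitive_on_powR; rewrite ?invr_ge0.
  have nz t : 1 + t `^ a != 0 by rewrite gt_eqF// ltr_pwDl// powR_ge0.
  have pV : primitive_on (n.+1%:R^-1) n.+1%:R (fun t : R => (1 + t `^ a)^-1)
      (fun t => - (1 + t `^ a) ^- 2 * (0 + a * t `^ (a - 1))).
    split; first by move=> t; apply: cvgV; [exact: nz|exact: pS.1].
    by move=> t tn; exact: (@is_deriveV _ (fun t => 1 + t `^ a) t _ 1 (nz t) (pS.2 t tn)).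
  have := primitive_onB (primitive_on_cst (n.+1%:R^-1) n.+1%:R 1) pV.
  by apply: primitive_on_eq => t _; rewrite sub0r.
- move=> n t /andP[/ltW/pos t0 _].
  rewrite ger0_norm; last exact: integrand_ge0.
  have ta0 : 0 <= t `^ a by exact: powR_ge0.
  have p0 : 0 < 1 + t `^ a by rewrite ltr_pwDl.
  rewrite /integrand /g add0r mulNr opprK.
  have -> : C * ((1 + t `^ a) ^- 2 * (a * t `^ (a - 1))) =
     t `^ (a - 1) * (C * a * (1 + t `^ a) ^- 2) by ring.
  apply: ler_wpM2l; first exact: powR_ge0.
  rewrite ler_pdivlMr ?exprn_gt0// /C divfK ?gt_eqF//.
  rewrite mulrC expRN ler_pdivrMr ?expR_gt0//.
  have h2 := @powR_le_expR (a + a) t (addr_gt0 a0 a0) (ltW t0).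
  have e1 : 1 <= expR t by rewrite -expR0 ler_expR ltW.
  move: h2; rewrite powRD; last by rewrite gt_eqF// addr_gt0.
  set X := t `^ a; set K := _ `^ (a + a) => h2.
  apply: (@le_trans _ _ (2 * (1 + X * X))); last first.
    by rewrite -mulrA ler_pM2l// mulrDl mul1r lerD.
  have : 0 <= (1 - X) ^+ 2 by exact: sqr_ge0.
  by rewrite !expr2; lra.
- move=> n; rewrite /G -mulrBr -[leRHS]mulr1; apply: ler_wpM2l => //.
  set X := _ `^ a; set Y := _ `^ a.
  have : 0 <= (1 + X)^-1 by rewrite invr_ge0 addr_ge0// powR_ge0.
  have : (1 + Y)^-1 <= 1 by rewrite invf_le1 ?lerDl ?powR_ge0// ltr_pwDl// powR_ge0.
  lra.
Qed.

Let gamma_partial a n : R := \int[mu]_(t in `[0, n%:R]) integrand a t.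

Let integrable_partial a x : 0 < a -> mu.-integrable `[0, x] (EFin \o integrand a).
Proof.
move=> a0; apply: integrableS (integrable_gamma_integrand a0) => //.
exact: subset_itvl.
Qed.

Let gamma_partial_cvg a : 0 < a -> gamma_partial a n @[n --> \oo] --> Gamma a.
Proof.
move=> a0; have intG := integrable_gamma_integrand a0.
rewrite /Gamma /Rintegral; apply/fine_cvg.
rewrite fineK; last exact: integrable_fin_num.
have -> : `[0 : R, +oo[%classic = \bigcup_n `[0 : R, n%:R]%classic.
  by rewrite itv_bndy_bigcup_BRight; under eq_bigcupr do rewrite add0r.
suff H : (\int[mu]_(x in `[0%R, i%:R]) (EFin \o integrand a) x)%E @[i --> \oo] -->
    (\int[mu]_(x in \bigcup_n `[0%R, n%:R]%classic) (EFin \o integrand a) x)%E.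
  exact: H.
apply: ge0_nondecreasing_set_cvg_integral => //.
- move=> n m nm; rewrite subsetEset; apply: subset_itvl; rewrite bnd_simp.
  by rewrite ler_nat.
- by move=> n; apply: (measurable_int mu); exact: integrable_partial.
- by move=> n x _; rewrite lee_fin; exact: integrand_ge0.
Qed.

(** On [[0, 1]] the integrand is at least [expR (-1) * t `^ (a - 1)]. *)
Lemma Gamma_gt0 a : 0 < a -> 0 < Gamma a.
Proof.
move=> a0; apply: (@lt_le_trans _ _ (gamma_partial a 1)).
  apply: (@lt_le_trans _ _ (expR (-1) / a * 1 `^ a - expR (-1) / a * 0 `^ a)).
    by rewrite powR1 powR0 ?gt_eqF// mulr0 subr0 mulr1 divr_gt0// expR_gt0.
  apply: (@le_primitive_Rintegral _ 0 1 (fun t => expR (-1) / a * t `^ a)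
     (fun t => expR (-1) / a * (a * t `^ (a - 1))) (integrand a)) => //.
  - exact: integrable_partial.
  - by move=> t /andP[t0 _]; exact: integrand_continuous.
  - by apply: primitive_onZ; exact: primitive_on_powR.
  - move=> t /andP[t0 t1]; rewrite mulrA divfK ?gt_eqF// mulrC.
    by apply: ler_wpM2l; [exact: powR_ge0|rewrite ler_expR lerN2 ltW].
rewrite -(cvg_lim _ (gamma_partial_cvg a0))//.
apply: limr_ge; first by apply/cvg_ex; eexists; exact: gamma_partial_cvg.
have fin n : (\int[mu]_(t in `[0%R, n%:R]) (integrand a t)%:E)%E \is a fin_num.
  by apply: integrable_fin_num => //; exact: integrable_partial.
near=> n; rewrite -lee_fin /gamma_partial /Rintegral !fineK//.
apply: ge0_subset_integral => //.
- by apply: (measurable_int mu); exact: integrable_partial.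
- by move=> x _; rewrite lee_fin; exact: integrand_ge0.
- by apply: subset_itvl; rewrite bnd_simp ler_nat; near: n; exact: nbhs_infty_ge.
Unshelve. all: by end_near. Qed.

(** Integration by parts on [[0, n]] leaves the boundary term
    [n `^ a * expR (- n)], which tends to [0]. *)
Lemma GammaS a : 0 < a -> Gamma (a + 1) = a * Gamma a.
Proof.
move=> a0; have a10 : 0 < a + 1 by rewrite addr_gt0.
have rec n : gamma_partial (a + 1) n =
    a * gamma_partial a n - n%:R `^ a * expR (- n%:R).
  have n0 : 0 <= n%:R :> R by [].
  have := @Rintegral_primitive _ 0 n%:R
    (fun x => a * \int[mu]_(t in `[0, x]) integrand a t - x `^ a * expR (- x))
    (integrand (a + 1)) n0 (integrable_partial _ a10).
  rewrite -/(gamma_partial (a + 1) n) => ->.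
  - rewrite set_itv1 Rintegral_set1 powR0 ?gt_eqF//; rewrite /gamma_partial; ring.
  - by move=> x /andP[x0 _]; exact: integrand_continuous.
  have pint : primitive_on 0 n%:R (fun x => \int[mu]_(t in `[0, x]) integrand a t)
      (integrand a).
    apply: primitive_on_Rintegral => //; first exact: integrable_partial.
    by move=> x /andP[x0 _]; exact: integrand_continuous.
  have := primitive_onB (primitive_onZ a pint)
    (primitive_onM (primitive_on_powR n%:R (lexx 0) a0) (primitive_on_expRN 0 n%:R)).
  apply: primitive_on_eq => x /andP[x0 _].
  rewrite /integrand addrK; ring.
have tail : n%:R `^ a * expR (- n%:R) @[n --> \oo] --> (0 : R).
  apply: (@squeeze_cvgr _ _ _ _ (fun=> 0)
     (fun n => (a + 1) `^ (a + 1) * (n%:R : R)^-1)).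
  - near=> n; have n0 : (0 : R) < n%:R by rewrite ltr0n; near: n; exact: nbhs_infty_gt.
    rewrite mulr_ge0 ?powR_ge0 ?expR_ge0//= ler_pdivlMr// expRN mulrAC.
    rewrite ler_pdivrMr ?expR_gt0//.
    by rewrite mulrC -{1}[a](addrK 1) mulr_powRB1 ?(ltW n0)// powR_le_expR// ltW.
  - exact: cvg_cst.
  - rewrite -[X in _ --> X](mulr0 ((a + 1) `^ (a + 1))).
    apply: cvgM; first exact: cvg_cst.
    apply/gtr0_cvgV0; last exact: cvgr_idn.
    by near=> n; rewrite ltr0n; near: n; exact: nbhs_infty_gt.
have lim1 := gamma_partial_cvg a10.
have lim2 : gamma_partial (a + 1) n @[n --> \oo] --> a * Gamma a.
  rewrite -[X in _ --> X]subr0; under eq_cvg do rewrite rec.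
  by apply: cvgB => //; apply: cvgM; [exact: cvg_cst|exact: gamma_partial_cvg].
exact: (cvg_unique _ lim1 lim2).
Unshelve. all: by end_near. Qed.

End gamma.

(** * A lower bound for the generalized beta function *)

Section beta.
Context {R : realType}.
Implicit Types (alpha sigma rho e x y : R).
Local Notation mu := (@lebesgue_measure R).

Lemma one_powR e : 1 `^ e = 1 :> R.
Proof. by rewrite powR1. Qed.

Lemma powR2_ge1 e : 0 <= e -> 1 <= 2 `^ e :> R.
Proof.
have two1 : 1 <= 2 :> R by rewrite ler1n.
by move=> e0; have := ler_powR two1 e0; rewrite powRr0.
Qed.

Lemma primitive_on_onem (a b : R) : primitive_on a b (fun y => 1 - y) (fun=> - 1).
Proof.
have := primitive_onB (primitive_on_cst a b 1) (primitive_on_id a b).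
by apply: primitive_on_eq => y _; rewrite sub0r.
Qed.

Lemma primitive_on_onem_powR e (b : R) : 0 < e -> b <= 1 ->
  primitive_on 0 b (fun y => (1 - y) `^ e) (fun y => - (e * (1 - y) `^ (e - 1))).
Proof.
move=> e0 b1; have pP := primitive_on_powR 1 (lexx 0) e0.
have := @primitive_on_comp _ 0 b 0 1 (fun y => y `^ e) _ (fun y => 1 - y) _
  _ _ pP (primitive_on_onem 0 b).
move=> H; apply: (primitive_on_eq _ (H _ _)) => y; first by rewrite mulrN1.
- by move=> /andP[? ?]; apply/andP; split; lra.
- by move=> /andP[? ?]; apply/andP; split; lra.
Qed.

(** In the variable [y = x `^ rho] the integral is the Euler integral of
    [y `^ sigma * (1 - y) `^ alpha]. Integration by parts multiplies it by
    [alpha + sigma + 1] and turns it into [alpha] times the integral of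
    [y `^ sigma * (1 - y) `^ (alpha - 1)], where [y <= y `^ sigma] yields
    [1 / (alpha + 1)]. The function [H] performs these steps at the level of
    primitives, which avoids the singularity of the last integrand at [1]. There
    is equality for [sigma = 1]. *)
Lemma le_beta_rho rho alpha sigma : 0 < rho -> 0 < alpha -> 0 < sigma -> sigma <= 1 ->
  ((alpha + 1) * (alpha + sigma + 1))^-1 <= beta_rho rho (sigma + 1) (alpha + 1).
Proof.
move=> rho0 alpha0 sigma0 sigma1.
have a10 : 0 < alpha + 1 by lra.
have s10 : 0 < sigma + 1 by lra.
have as0 : 0 < alpha + sigma + 1 by lra.
pose c := (alpha + sigma + 1)^-1.
rewrite /beta_rho !addrK.
pose H y := c * (y `^ (sigma + 1) * (1 - y) `^ alpha
  - (y * (1 - y) `^ alpha + (alpha + 1)^-1 * (1 - y) `^ (alpha + 1))).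
have pS : primitive_on 0 1 (fun y : R => y `^ (sigma + 1))
    (fun y => (sigma + 1) * y `^ sigma).
  have := primitive_on_powR 1 (lexx 0) s10.
  by apply: primitive_on_eq => y _; rewrite addrK.
have pA := primitive_on_onem_powR alpha0 (lexx 1).
have pA1 : primitive_on 0 1 (fun y : R => (1 - y) `^ (alpha + 1))
    (fun y => - ((alpha + 1) * (1 - y) `^ alpha)).
  have := primitive_on_onem_powR a10 (lexx 1).
  by apply: primitive_on_eq => y _; rewrite addrK.
have pH := primitive_onZ c (primitive_onB (primitive_onM pS pA)
  (primitive_onD (primitive_onM (primitive_on_id 0 1) pA)
     (primitive_onZ (alpha + 1)^-1 pA1))).
have pX := primitive_on_powR 1 (lexx 0) rho0.
have x01 x : 0 < x < 1 -> 0 < x `^ rho < 1.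
  move=> /andP[x0 x1]; rewrite powR_gt0//= -[ltRHS](one_powR rho).
  by apply: gt0_ltr_powR => //; rewrite nnegrE ltW.
have x01' x : 0 <= x <= 1 -> 0 <= x `^ rho <= 1.
  move=> /andP[x0 x1]; rewrite powR_ge0//= -[leRHS](one_powR rho).
  by apply: ge0_ler_powR; rewrite ?nnegrE// ltW.
have pF := primitive_on_comp x01' x01 pH pX.
have -> : ((alpha + 1) * (alpha + sigma + 1))^-1 = H (1 `^ rho) - H (0 `^ rho).
  rewrite /H powR1 powR0 ?gt_eqF// subrr subr0 !powR1 !powR0 ?gt_eqF//.
  by rewrite invfM /c; ring.
have cont x : 0 < x < 1 -> {for x, continuous (fun x =>
    rho * (1 - x `^ rho) `^ alpha * (x `^ rho) `^ sigma * x `^ (rho - 1))}.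
  move=> xx; have /andP[x0 x1] := xx; have /andP[X0 X1] := x01 _ xx.
  have cX : {for x, continuous (fun t => t `^ rho)} by exact: powR_continuous_pos.
  apply: cvgM; last exact: powR_continuous_pos.
  apply: cvgM; last first.
    by apply: (@continuous_comp _ _ _ (fun t : R => t `^ rho) (fun t => t `^ sigma)) => //;
       exact: powR_continuous_pos.
  apply: cvgM; first exact: cvg_cst.
  apply: (@continuous_comp _ _ _ (fun t : R => 1 - t `^ rho) (fun t => t `^ alpha)).
    by apply: cvgB => //; exact: cvg_cst.
  by apply: powR_continuous_pos; rewrite subr_gt0.
apply: (le_primitive_Rintegral ler01 _ cont pF).
- apply: (integrable_dominated_by_derivative ltr01 cont pX) => x xx.
  have /andP[X0 X1] := x01 _ xx.
  rewrite ger0_norm ?mulr_ge0 ?powR_ge0 ?(ltW rho0)//.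
  apply: ler_wpM2r; first exact: powR_ge0.
  rewrite -mulrA ler_piMr ?(ltW rho0)// mulr_ile1 ?powR_ge0//.
    rewrite -[leRHS](one_powR alpha); apply: ge0_ler_powR; rewrite ?nnegrE ?(ltW alpha0)//; lra.
  rewrite -[leRHS](one_powR sigma); apply: ge0_ler_powR; rewrite ?nnegrE ?(ltW sigma0)//; lra.
- move=> x xx; have /andP[X0 X1] := x01 _ xx.
  set X := x `^ rho in X0 X1 *.
  set Z := (1 - X) `^ (alpha - 1); set Y := X `^ sigma.
  have Z0 : 0 <= Z by exact: powR_ge0.
  have XY : X <= Y by apply: ger1_powR => //; rewrite X0 ltW.
  have eA : (1 - X) `^ alpha = (1 - X) * Z by rewrite mulr_powRB1//; lra.
  have eS : X `^ (sigma + 1) = X * Y.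
    by rewrite -mulr_powRB1 ?addrK// ltW.
  rewrite eA eS.
  have -> : rho * ((1 - X) * Z) * Y * x `^ (rho - 1) =
      c * ((alpha + sigma + 1) * ((1 - X) * Z * Y)) * (rho * x `^ (rho - 1)).
    by rewrite [c * (_ * _)]mulrA /c mulVf ?gt_eqF//; ring.
  apply: ler_wpM2r; first by rewrite mulr_ge0 ?powR_ge0 ?(ltW rho0).
  apply: ler_wpM2l; first by rewrite invr_ge0 ltW.
  rewrite [(alpha + 1)^-1 * _]mulrN mulKf ?gt_eqF//.
  have : 0 <= alpha * Z * (Y - X) by rewrite !mulr_ge0 ?(ltW alpha0)// subr_ge0.
  lra.
Qed.

End beta.

(** * Elementary numerical inequalities *)

Section exponential_bounds.
Context {R : realType}.
Implicit Types (alpha p x z : R).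

Lemma primitive_on_expR (a b : R) : primitive_on a b (@expR R) (@expR R).
Proof.
split; last by move=> x _; exact: is_derive_expR.
by apply: continuous_subspaceT => x; exact: continuous_expR.
Qed.

Lemma expR_ge_quadratic z : 0 <= z -> 1 + z + z * z / 2 <= expR z.
Proof.
move=> z0; have pid := primitive_on_id 0 z.
have pQ := primitive_onD pid (primitive_onZ 2^-1 (primitive_onM pid pid)).
have := le_increment z0 pQ (primitive_on_expR 0 z).
rewrite expR0 => H.
suff : z + 2^-1 * (z * z) - (0 + 2^-1 * (0 * 0)) <= expR z - 1 by lra.
apply: H => x _; rewrite !mulr1; have := expR_ge1Dx x; lra.
Qed.

(** For [z = 2 / (2 * x + 1)] this says [2 / (2 * x + 1) <= ln (1 + 1 / x)], a
    bound exact to second order in [1 / x]; [1 / (x + 1)] would be too weak. *)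
Lemma expR_le_pade z : 0 <= z -> expR z * (2 - z) <= 2 + z.
Proof.
move=> z0; have pid := primitive_on_id 0 z.
have pC c := primitive_on_cst 0 z c.
(* After multiplication by exp(-x) the difference has a derivative of constant
   sign. *)
have pE := primitive_on_expRN 0 z.
have := le_increment z0 (primitive_onB (pC 2) pid)
  (primitive_onM (primitive_onD (pC 2) pid) pE).
rewrite subr0 addr0 oppr0 expR0 mulr1 => H.
have : 2 - z - 2 <= (2 + z) * expR (- z) - 2.
  apply: H => x /andP[x0 _].
  have := expR_ge1Dx x; rewrite expRN => ex.
  rewrite !add0r mulr1 mulrN -subr_ge0.
  have e0 : 0 < expR x by exact: expR_gt0.
  have -> : - ((2 + x) * (expR x)^-1) + (expR x)^-1 - - 1 =
    (expR x - (1 + x)) * (expR x)^-1.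
    by rewrite mulrBl mulfV ?gt_eqF//; ring.
  by rewrite mulr_ge0 ?invr_ge0 ?(ltW e0)// subr_ge0.
rewrite lerD2r expRN ler_pdivlMr ?expR_gt0// mulrC; exact.
Qed.

Lemma ln2_ge : 2 / 3 <= ln 2 :> R.
Proof.
rewrite -ler_expR lnK ?posrE//.
have := @expR_le_pade (2 / 3); move: (expR _) => e H.
have : e * (2 - 2 / 3) <= 2 + 2 / 3 by apply: H; lra.
lra.
Qed.

Lemma ln2_le : ln 2 <= 7 / 10 :> R.
Proof.
rewrite -ler_expR lnK ?posrE//.
(* The quadratic bound is too weak at 7/10 itself, but not at a quarter of it;
   likewise an eighth is used for expR 1 below. *)
have -> : (7 / 10 : R) = 7 / 40 * 4%:R by lra.
have : 1 + 7 / 40 + 7 / 40 * (7 / 40) / 2 <= expR (7 / 40) :> R.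
  by apply: expR_ge_quadratic; lra.
rewrite expRM_natr; move: (expR _) => e e1.
have e2 : (11903 / 10000) ^+ 2 <= e ^+ 2 by rewrite lerXn2r ?nnegrE; lra.
have : ((11903 / 10000) ^+ 2) ^+ 2 <= (e ^+ 2) ^+ 2.
  by rewrite lerXn2r ?nnegrE ?sqr_ge0.
rewrite -exprM; lra.
Qed.

Lemma expR1_ge : 27 / 10 <= expR 1 :> R.
Proof.
have -> : (1 : R) = 1 / 8 * 8%:R by lra.
have : 1 + 1 / 8 + 1 / 8 * (1 / 8) / 2 <= expR (1 / 8) :> R.
  by apply: expR_ge_quadratic; lra.
rewrite expRM_natr; move: (expR _) => e e1.
have : (11328 / 10000) ^+ 8 <= e ^+ 8 by rewrite lerXn2r ?nnegrE; lra.
lra.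
Qed.

(** As [alpha] grows the two sides compare like [2] and [27 / 10] times
    [alpha ^+ 2], but for moderate [alpha] the term [2 `^ (- alpha)] is needed;
    its convexity gives tangent lines at [0] and at [3] that are good enough on
    [[0, 1]] and on [[1, 4]]. *)
Lemma onem_pow2_le alpha : 0 < alpha ->
  (1 - 2 `^ (- alpha)) * ((alpha + 2) * (2 * alpha + 3)) <=
  27 / 10 * (alpha + 1) ^+ 2.
Proof.
move=> a0; have l1 := ln2_ge; have l2 := ln2_le.
have E : 2 `^ (- alpha) = expR (- alpha * ln 2) by rewrite /powR gt_eqF.
have W0 : 0 < (alpha + 2) * (2 * alpha + 3) by rewrite mulr_gt0; lra.
(* It suffices to bound 1 - 2^(-alpha) by a piecewise affine function. *)
have suff_le c : 1 - 2 `^ (- alpha) <= c ->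
    c * ((alpha + 2) * (2 * alpha + 3)) <= 27 / 10 * (alpha + 1) ^+ 2 ->
    (1 - 2 `^ (- alpha)) * ((alpha + 2) * (2 * alpha + 3)) <=
    27 / 10 * (alpha + 1) ^+ 2.
  by move=> h; apply: le_trans; rewrite ler_pM2r.
have tangent3 : (1 + (3 - alpha) * ln 2) / 8 <= 2 `^ (- alpha).
  have aE : - alpha = (3 - alpha) + (- 3%:R) by lra.
  rewrite [X in _ <= _ `^ X]aE powRD; last by rewrite pnatr_eq0 implybT.
  rewrite powR_invn// (_ : 2 ^- 3 = 8^-1 :> R); last by rewrite -natrX.
  rewrite ler_pM2r ?invr_gt0// /powR gt_eqF//; exact: expR_ge1Dx.
have [a1|a1] := leP alpha 1.
  apply: (suff_le (7 / 10 * alpha)).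
    rewrite E; have := expR_ge1Dx (- alpha * ln 2).
    have : alpha * ln 2 <= alpha * (7 / 10) by rewrite ler_pM2l.
    lra.
  have : 0 <= (1 - alpha) * (alpha * alpha) by rewrite !mulr_ge0; lra.
  have : 0 <= (1 - alpha) * alpha by rewrite mulr_ge0; lra.
  rewrite expr2; lra.
have [a3|a3] := leP alpha 3.
  apply: (suff_le (7 / 8 - (3 - alpha) / 12)).
    have : (3 - alpha) * (2 / 3) <= (3 - alpha) * ln 2 by rewrite ler_wpM2l; lra.
    lra.
  have [t0 t2] : 0 <= alpha - 1 /\ alpha - 1 <= 2 by split; lra.
  have -> : alpha = 1 + (alpha - 1) by ring.
  move: (alpha - 1) t0 t2 => t t0 t2.
  have : 0 <= (2 - t) * (t * t) by rewrite !mulr_ge0; lra.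
  have : 0 <= t * t by rewrite mulr_ge0.
  rewrite expr2; lra.
have [a4|a4] := leP alpha 4.
  apply: (suff_le (7 / 8 + 7 / 80 * (alpha - 3))).
    have : (alpha - 3) * ln 2 <= (alpha - 3) * (7 / 10) by rewrite ler_wpM2l; lra.
    lra.
  have [t0 t1] : 0 <= alpha - 3 /\ alpha - 3 <= 1 by split; lra.
  have -> : alpha = 3 + (alpha - 3) by ring.
  move: (alpha - 3) t0 t1 => t t0 t1.
  have : 0 <= (1 - t) * (t * t) by rewrite !mulr_ge0; lra.
  have : 0 <= (1 - t) * t by rewrite mulr_ge0; lra.
  rewrite expr2; lra.
apply: (suff_le 1); first by rewrite lerBlDr lerDl powR_ge0.
have : 0 <= (alpha - 4) * (alpha - 4) by apply: mulr_ge0; lra.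
rewrite expr2; lra.
Qed.

(** For fixed [K = (alpha + 1) / (alpha + 2)] the maximum of [p * K `^ (p - 1)]
    over [p] is [expR (k - 1) / k] with [k = - ln K]; the inequality
    [p * d <= expR (p * d - 1)] gives the same bound with the lower estimate
    [d = 2 / (2 * alpha + 3)] of [k]. What remains depends on [alpha] only. *)
Lemma weight_constant_le alpha p : 0 < alpha -> 1 < p ->
  p * ((alpha + 1) / (alpha + 2)) `^ (p - 1) *
    (2 * (1 - 2 `^ (- alpha)) / (alpha + 1)) <= 1.
Proof.
move=> a0 p1; pose d : R := 2 / (2 * alpha + 3).
have c0 : 0 < 2 * alpha + 3 by lra.
have a10 : 0 < alpha + 1 by lra.
have a20 : 0 < alpha + 2 by lra.
have d0 : 0 < d by rewrite divr_gt0.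
have dE : d * (2 * alpha + 3) = 2 by rewrite divfK// gt_eqF.
set K := (alpha + 1) / (alpha + 2).
have K0 : 0 < K by rewrite divr_gt0.
have Kd : expR d * K <= 1.
  rewrite mulrA ler_pdivrMr// mul1r.
  have := @expR_le_pade d (ltW d0).
  have e2 : 2 - d = (2 * (alpha + 1)) * d.
    by rewrite -[X in X - _]dE; ring.
  have e3 : 2 + d = (2 * (alpha + 2)) * d.
    by rewrite -[X in X + _]dE; ring.
  rewrite e2 e3 mulrA ler_pM2r//; lra.
have Kp : K `^ (p - 1) <= expR (- ((p - 1) * d)).
  rewrite expRN mulrC expRM -powRN.
  have Kd' : K <= expR d `^ (-1).
    by rewrite powR_inv1 ?expR_ge0// -[_^-1]mul1r ler_pdivlMr ?expR_gt0// mulrC.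
  rewrite -[- (p - 1)]mulN1r powRrM; apply: ge0_ler_powR => //.
  - lra.
  - by rewrite nnegrE ltW.
  - by rewrite nnegrE powR_ge0.
have pKp : p * K `^ (p - 1) <= expR d / expR 1 / d.
  have h : p * d <= expR (p * d - 1) by have := expR_ge1Dx (p * d - 1); lra.
  rewrite ler_pdivlMr//.
  apply: (@le_trans _ _ (p * d * expR (- ((p - 1) * d)))).
    rewrite mulrAC ler_pM2l//; apply: mulr_gt0 => //; lra.
  apply: (@le_trans _ _ (expR (p * d - 1) * expR (- ((p - 1) * d)))).
    by rewrite ler_wpM2r ?expR_ge0.
  rewrite -expRD -expRN -expRD ler_expR; lra.
set M := 2 * (1 - 2 `^ (- alpha)) / (alpha + 1).
have M0 : 0 <= M.
  rewrite divr_ge0 ?(ltW a10)// mulr_ge0// subr_ge0 powRN invf_le1 ?powR_gt0//.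
  by apply: powR2_ge1; exact: ltW.
apply: (le_trans (ler_wpM2r M0 pKp)).
rewrite mulrAC ler_pdivrMr// mul1r mulrAC ler_pdivrMr ?expR_gt0//.
apply: (@le_trans _ _ (d * (27 / 10))); last by rewrite ler_pM2l// expR1_ge.
have ed : expR d <= (alpha + 2) / (alpha + 1).
  by rewrite ler_pdivlMr//; move: Kd; rewrite mulrA ler_pdivrMr// mul1r.
apply: (le_trans (ler_wpM2r M0 ed)).
rewrite /M /d mulrACA -invfM ler_pdivrMr ?mulr_gt0//.
have -> : 2 / (2 * alpha + 3) * (27 / 10) * ((alpha + 1) * (alpha + 1)) =
   27 / 5 * (alpha + 1) ^+ 2 / (2 * alpha + 3) by rewrite expr2; field; rewrite gt_eqF.
by rewrite ler_pdivlMr//; have := onem_pow2_le a0; lra.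
Qed.

End exponential_bounds.

(** * The fractional trapezoidal defect on the unit interval *)

Section trapezoid.
Context {R : realType}.
Implicit Types (alpha sigma tau c p q x y : R).
Local Notation mu := (@lebesgue_measure R).

Lemma powR_weight_integrable alpha (f : R -> R) : 0 < alpha ->
  {within `[0, 1], continuous f} ->
  mu.-integrable `[0, 1] (EFin \o (fun t => t `^ (alpha - 1) * f t)).
Proof.
move=> a0 cf.
have cnf : {within `[0, 1], continuous (fun x => `|f x|)}.
  by move=> x; apply: cvg_norm; exact: cf.
have [m _ fm] := EVT_max ler01 cnf.
have pG := primitive_onZ (`|f m| / alpha) (primitive_on_powR 1 (lexx 0) a0).
apply: (integrable_dominated_by_derivative ltr01 _ pG).
- move=> x /[dup] x01 /andP[x0 x1]; apply: cvgM; first exact: powR_continuous_pos.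
  exact: (within_continuous_continuous ltr01 cf).
- move=> x /andP[x0 x1]; rewrite normrM (ger0_norm (powR_ge0 _ _)) mulrA divfK ?gt_eqF//.
  by rewrite mulrC ler_wpM2r ?powR_ge0// fm// in_itv/= !ltW.
Qed.

Lemma primitive_on_reflect (F f : R -> R) :
  primitive_on 0 1 F f -> primitive_on 0 1 (fun y => F (1 - y)) (fun y => - f (1 - y)).
Proof.
move=> pF; have := @primitive_on_comp _ 0 1 0 1 F f (fun y => 1 - y) (fun=> - 1).
move=> /(_ _ _ pF (primitive_on_onem 0 1)) H.
apply: (primitive_on_eq _ (H _ _)) => x; first by rewrite mulrN1.
- by move=> /andP[? ?]; apply/andP; split; lra.
- by move=> /andP[? ?]; apply/andP; split; lra.
Qed.

(** Up to the factor [2], the error of the trapezoidal rule for the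
    Riemann-Liouville means of [phi] on [[0, 1]]. *)
Definition trapezoid_defect alpha (phi : R -> R) : R :=
  phi 0 + phi 1 - alpha * (\int[mu]_(t in `[0, 1]) (t `^ (alpha - 1) * phi t)
    + \int[mu]_(t in `[0, 1]) (t `^ (alpha - 1) * phi (1 - t))).

(** Let [S y = phi y + phi (1 - y)]. The kernel [alpha * t `^ (alpha - 1)] has
    mass [1], so the defect is the integral of
    [alpha * t `^ (alpha - 1) * (S 0 - S t)]; folding at [1 / 2] by the symmetry
    of [S] makes it the integral over [[0, 1 / 2]] of
    [alpha * (y `^ (alpha - 1) + (1 - y) `^ (alpha - 1)) * (S 0 - S y)]. There
    [S 0 - S y] is bounded by [N y], a primitive of a bound on the derivative of
    [S]. *)
Lemma trapezoid_defect_le alpha (phi dphi N n V dV : R -> R) : 0 < alpha ->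
  primitive_on 0 1 phi dphi ->
  primitive_on 0 (1 / 2) N n -> primitive_on 0 (1 / 2) V dV ->
  N 0 = 0 ->
  (forall y, 0 < y < 1 / 2 -> `|dphi y - dphi (1 - y)| <= n y) ->
  (forall y, 0 < y < 1 / 2 ->
    alpha * (y `^ (alpha - 1) + (1 - y) `^ (alpha - 1)) * N y <= dV y) ->
  `|trapezoid_defect alpha phi| <= V (1 / 2) - V 0.
Proof.
move=> a0 pphi pN pV N0 dn NV.
have h2 : 0 <= 1 / 2 :> R by lra.
have h12 : 1 / 2 <= 1 :> R by lra.
have pphi' := primitive_on_reflect pphi.
have prim (f : R -> R) : {within `[0, 1], continuous f} ->
    primitive_on 0 1 (fun x => \int[mu]_(t in `[0, x]) (t `^ (alpha - 1) * f t))
      (fun t => t `^ (alpha - 1) * f t).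
  move=> cf; apply: primitive_on_Rintegral => //; first exact: powR_weight_integrable.
  move=> x /[dup] x01 /andP[x0 x1]; apply: cvgM; first exact: powR_continuous_pos.
  exact: (within_continuous_continuous ltr01 cf).
pose S y := phi y + phi (1 - y).
pose D x := S 0 * x `^ alpha
  - alpha * (\int[mu]_(t in `[0, x]) (t `^ (alpha - 1) * phi t)
    + \int[mu]_(t in `[0, x]) (t `^ (alpha - 1) * phi (1 - t))).
have pD : primitive_on 0 1 D (fun y => alpha * y `^ (alpha - 1) * (S 0 - S y)).
  have := primitive_onB (primitive_onZ (S 0) (primitive_on_powR 1 (lexx 0) a0))
    (primitive_onZ alpha (primitive_onD (prim _ pphi.1) (prim _ pphi'.1))).
  by apply: primitive_on_eq => y _; rewrite /S; ring.
have SE y : S (1 - y) = S y by rewrite /S subKr addrC.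
have pE := primitive_on_sub (lexx 0) h12 (primitive_onB pD (primitive_on_reflect pD)).
have D0 : D 0 = 0.
  by rewrite /D powR0 ?gt_eqF// set_itv1 !Rintegral_set1; ring.
have -> : trapezoid_defect alpha phi =
    (D (1 / 2) - D (1 - 1 / 2)) - (D 0 - D (1 - 0)).
  have -> : 1 - 1 / 2 = 1 / 2 :> R by lra.
  rewrite subr0 D0.
  by rewrite subrr !sub0r opprK /D one_powR mulr1 /S subr0.
apply: (norm_le_increment h2 pE pV) => y y01; apply: le_trans (NV _ y01).
have /andP[y0 y1] := y01.
rewrite SE [X in `|X|](_ : _ =
  alpha * (y `^ (alpha - 1) + (1 - y) `^ (alpha - 1)) * (S 0 - S y)); last by ring.
rewrite normrM ger0_norm; last by rewrite mulr_ge0 ?addr_ge0 ?powR_ge0 ?(ltW a0).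
apply: ler_wpM2l; first by rewrite mulr_ge0 ?addr_ge0 ?powR_ge0 ?(ltW a0).
have pS := primitive_onD pphi pphi'.
have y01' : y <= 1 by lra.
have := norm_le_increment (ltW y0) (primitive_on_sub (lexx 0) y01' pS)
  (primitive_on_sub (lexx 0) (ltW y1) pN).
rewrite N0 !subr0 => le_N; rewrite distrC /S subr0; apply: le_N => z /andP[z0 zy].
by apply: dn; rewrite z0 (lt_trans zy).
Qed.

Lemma primitive_on_power_moment tau : 0 <= tau ->
  primitive_on 0 (1 / 2) (fun y : R => (1 - (1 - y) `^ (tau + 1)) / (tau + 1))
    (fun y => (1 - y) `^ tau).
Proof.
move=> t0; have t1 : 0 < tau + 1 by lra.
have h12 : 1 / 2 <= 1 :> R by lra.
have := primitive_onZ (tau + 1)^-1 (primitive_onB (primitive_on_cst 0 (1/2) 1)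
  (primitive_on_onem_powR t1 h12)).
rewrite (_ : (fun x => _) = (fun y : R => (1 - (1 - y) `^ (tau + 1)) / (tau + 1))).
  by apply: primitive_on_eq => y _; rewrite sub0r opprK addrK mulKf ?gt_eqF.
by apply/funext => y; rewrite mulrC.
Qed.

(** The primitive obtained by integrating by parts the kernel
    [alpha * (y `^ (alpha - 1) + (1 - y) `^ (alpha - 1))], which is minus the
    derivative of [(1 - y) `^ alpha - y `^ alpha], against a primitive of
    [(1 - y) `^ tau], after replacing [y `^ alpha * (1 - y) `^ tau] by the
    smaller [y `^ (alpha + tau)] so that a closed form remains. *)
Definition moment_majorant alpha tau y : R :=
  - (((1 - y) `^ alpha - y `^ alpha) * ((1 - (1 - y) `^ (tau + 1)) / (tau + 1)))
  + (alpha + tau + 1)^-1 * (1 - (1 - y) `^ (alpha + tau + 1) - y `^ (alpha + tau + 1)).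

Lemma primitive_on_moment_majorant alpha tau : 0 < alpha -> 0 <= tau ->
  exists2 dV, primitive_on 0 (1 / 2) (moment_majorant alpha tau) dV &
    forall y, 0 < y < 1 / 2 ->
    alpha * (y `^ (alpha - 1) + (1 - y) `^ (alpha - 1))
      * ((1 - (1 - y) `^ (tau + 1)) / (tau + 1)) <= dV y.
Proof.
move=> a0 t0; have e0 : 0 < alpha + tau + 1 by lra.
have h12 : 1 / 2 <= 1 :> R by lra.
have pw := primitive_onB (primitive_on_onem_powR a0 h12)
  (primitive_on_powR (1/2) (lexx 0) a0).
have pQ := primitive_onD (primitive_onN (primitive_onM pw (primitive_on_power_moment t0)))
  (primitive_onZ (alpha + tau + 1)^-1 (primitive_onB
    (primitive_onB (primitive_on_cst 0 (1/2) 1) (primitive_on_onem_powR e0 h12))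
    (primitive_on_powR (1/2) (lexx 0) e0))).
eexists; first exact: pQ.
move=> y /andP[y0 y1] /=; rewrite addrK.
set n := _ / (tau + 1).
have -> : (alpha + tau + 1)^-1 *
  (0 - - ((alpha + tau + 1) * (1 - y) `^ (alpha + tau)) -
   (alpha + tau + 1) * y `^ (alpha + tau)) =
  (1 - y) `^ (alpha + tau) - y `^ (alpha + tau).
  by rewrite sub0r opprK -mulrBr mulKf ?gt_eqF.
rewrite (@powRD _ (1 - y) alpha tau); last by apply/implyP => _; rewrite gt_eqF//; lra.
rewrite (@powRD _ y alpha tau); last by apply/implyP => _; rewrite gt_eqF//; lra.
have : 0 <= y `^ alpha * ((1 - y) `^ tau - y `^ tau).
  rewrite mulr_ge0 ?powR_ge0// subr_ge0; apply: ge0_ler_powR; rewrite ?nnegrE//; lra.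
lra.
Qed.

Lemma moment_majorant0 alpha tau : 0 < alpha -> 0 <= tau ->
  moment_majorant alpha tau 0 = 0.
Proof.
move=> a0 t0; rewrite /moment_majorant subr0 !one_powR !subrr mul0r.
have e0 : alpha + tau + 1 != 0 by rewrite gt_eqF//; lra.
by rewrite (powR0 e0); ring.
Qed.

Lemma moment_majorant_half alpha tau : 0 < alpha -> 0 <= tau ->
  moment_majorant alpha tau (1 / 2) =
  (1 - 2 `^ (- (alpha + tau))) / (alpha + tau + 1).
Proof.
move=> a0 t0; have half : 1 - 1 / 2 = 1 / 2 :> R by lra.
rewrite /moment_majorant half.
rewrite subrr mul0r oppr0 add0r mulrC; congr (_ / _).
have -> : (1 / 2 : R) `^ (alpha + tau + 1) = 2 `^ (- (alpha + tau)) / 2.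
  rewrite div1r -powR_inv1// -powRrM mulN1r opprD powRD; last by rewrite pnatr_eq0 implybT.
  by rewrite powR_inv1.
lra.
Qed.

(** Young's inequality for [(y / x) `^ q^-1 * 1]; it is an equality at [y = x],
    and [x] is left free to be optimised. *)
Lemma conjugate_scale p q x y : 0 < p -> 0 < q -> p^-1 + q^-1 = 1 ->
  0 < x -> 0 <= y -> y `^ q^-1 <= x `^ q^-1 * (y / (q * x) + p^-1).
Proof.
move=> p0 q0 pq x0 y0.
have yx0 : 0 <= y / x by rewrite divr_ge0// ltW.
have -> : y `^ q^-1 = x `^ q^-1 * (y / x) `^ q^-1.
  by rewrite -powRM ?(ltW x0)// mulrC divfK// gt_eqF.
apply: ler_wpM2l; first exact: powR_ge0.
have := @conjugate_powR R ((y / x) `^ q^-1) 1 q p (powR_ge0 _ _) ler01 q0 p0.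
rewrite addrC pq => /(_ erefl).
rewrite mulr1 -powRrM mulVf ?gt_eqF// powRr1// one_powR.
by rewrite invfM mulrA [y / q / x]mulrAC mul1r.
Qed.

(** Young's inequality bounds [(1 - y) `^ (sigma / q)] by an affine function of
    [(1 - y) `^ sigma], whose two moments against the kernel are known. The
    best scale gives the bound that Hoelder's inequality would give. *)
Lemma trapezoid_defect_power_le alpha sigma c p q (phi dphi : R -> R) :
  0 < alpha -> 0 < sigma -> 0 < p -> 0 < q -> p^-1 + q^-1 = 1 -> 0 <= c ->
  primitive_on 0 1 phi dphi ->
  (forall y, 0 < y < 1 / 2 -> `|dphi y - dphi (1 - y)| <= c * (1 - y) `^ (sigma / q)) ->
  `|trapezoid_defect alpha phi| <=
    c * (((1 - 2 `^ (- alpha)) / (alpha + 1)) `^ p^-1 *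
    ((1 - 2 `^ (- (alpha + sigma))) / (alpha + sigma + 1)) `^ q^-1).
Proof.
move=> a0 s0 p0 q0 pq c0 pphi dphic.
have as0 : 0 < alpha + sigma by lra.
have frac_gt0 x : 0 < x -> 0 < (1 - 2 `^ (- x)) / (x + 1).
  move=> x0; apply: divr_gt0; last by rewrite addr_gt0.
  rewrite subr_gt0 powRN invf_lt1 ?powR_gt0//.
  have := @gt0_ltr_powR R x x0 1 2; rewrite one_powR; apply; rewrite ?nnegrE//.
  by rewrite ltr1n.
set m := (1 - 2 `^ (- alpha)) / (alpha + 1).
set J := (1 - 2 `^ (- (alpha + sigma))) / (alpha + sigma + 1).
have m0 : 0 < m by exact: frac_gt0.
have J0 : 0 < J by exact: frac_gt0.
(* The scale that balances the two terms of Young's inequality. *)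
pose X := J / m; have X0 : 0 < X by rewrite divr_gt0.
pose A := c * (X `^ q^-1 / (q * X)); pose B := c * (X `^ q^-1 / p).
have A0 : 0 <= A by rewrite mulr_ge0// divr_ge0 ?powR_ge0// mulr_ge0// ltW.
have B0 : 0 <= B by rewrite mulr_ge0// divr_ge0 ?powR_ge0// ltW.
have [dV1 pV1 hV1] := primitive_on_moment_majorant a0 (ltW s0).
have [dV2 pV2 hV2] := primitive_on_moment_majorant a0 (lexx 0).
have pN := primitive_onD (primitive_onZ A (primitive_on_power_moment (ltW s0)))
  (primitive_onZ B (primitive_on_power_moment (lexx 0))).
have pV := primitive_onD (primitive_onZ A pV1) (primitive_onZ B pV2).
have := trapezoid_defect_le a0 pphi pN pV.
rewrite !moment_majorant0 ?moment_majorant_half ?(ltW s0)// !addr0 -/m -/J.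
have -> : A * J + B * m - (A * 0 + B * 0) = c * (m `^ p^-1 * J `^ q^-1).
  have mE : m `^ p^-1 = m / m `^ q^-1.
    have -> : p^-1 = 1 - q^-1 by lra.
    rewrite powRB; last by apply/implyP => _; rewrite gt_eqF.
    by rewrite powRr1// ltW.
  have XE : X `^ q^-1 = J `^ q^-1 / m `^ q^-1.
    rewrite /X powRM ?invr_ge0 ?(ltW J0) ?(ltW m0)//.
    by rewrite -[m^-1]powR_inv1 ?(ltW m0)// -powRrM mulN1r powRN.
  have AJ : A * J = c * X `^ q^-1 * m / q.
    rewrite /A /X; move: (_ `^ _) => Z; field.
    by rewrite !gt_eqF.
  have -> : A * J + B * m - (A * 0 + B * 0) = c * X `^ q^-1 * m * (p^-1 + q^-1).
    by rewrite AJ /B; ring.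
  rewrite pq XE mE; ring.
apply.
- by rewrite subr0 !one_powR subrr !mul0r !mulr0 addr0.
- move=> y /[dup] y01 /dphic /le_trans; apply.
  have /andP[y0 y1] := y01.
  rewrite powRrM powRr0 mulr1.
  have := @conjugate_scale p q X ((1 - y) `^ sigma) p0 q0 pq X0 (powR_ge0 _ _).
  move=> /(ler_wpM2l c0) /le_trans; apply.
  rewrite le_eqVlt; apply/orP; left; apply/eqP; rewrite /A /B; ring.
- move=> y y01; have := ler_wpM2l A0 (hV1 _ y01); have := ler_wpM2l B0 (hV2 _ y01).
  by rewrite add0r; lra.
Qed.

End trapezoid.

(** * Derivatives with generalized convex powers *)

Section derivative_gap.
Context {R : realType}.
Implicit Types (p q sigma x y z : R) (phi d : R -> R).

(** Excludes the endpoints as minimum points in the intermediate value theorem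
    for derivatives. *)
Lemma near_right_lt_of_derive_lt0 phi x (l : R) :
  is_derive x 1 phi l -> l < 0 -> \forall h \near 0^'+, phi (x + h) < phi x.
Proof.
move=> [dphi <-] l0; move: dphi; rewrite /derivable => /cvg_ex[/= k ck].
have kE : k = 'D_1 phi x by rewrite /derive; apply/esym/cvg_lim.
rewrite -kE in l0.
have ck' : h^-1 *: (phi (h *: 1 + x) - phi x) @[h --> 0^'+] --> k.
  apply: cvg_trans ck; apply: cvg_app.
  by move=> A [e e0 Ae]; exists e => // h he h0; apply: Ae => //; exact: lt0r_neq0.
near=> h.
have h0 : 0 < h by near: h; exact: nbhs_right_gt.
have : h^-1 *: (phi (h *: 1 + x) - phi x) < 0 by near: h; exact: (cvgr_lt _ ck').
rewrite [h *: 1]mulr1 addrC pmulr_rlt0 ?invr_gt0//.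
by rewrite addrC subr_lt0 addrC.
Unshelve. all: by end_near. Qed.

(** The signs of [d a] and [d b] force the minimum of [phi] over [[a, b]] to be
    attained inside. *)
Lemma darboux_lt phi d (a b : R) : a < b ->
  (forall x, a <= x <= b -> is_derive x 1 phi (d x)) -> d a < 0 -> 0 < d b ->
  exists2 z, a < z < b & d z = 0.
Proof.
move=> ab dphi da db.
have ba0 : 0 < b - a by rewrite subr_gt0.
have dphi' x : x \in `[a, b] -> derivable phi x 1.
  by rewrite in_itv/= => /dphi[].
have [c] := EVT_min (ltW ab) (derivable_within_continuous dphi').
rewrite in_itv/= => /andP[ac cb] cmin.
have ca : c != a.
  apply/eqP => ca; have da' := near_right_lt_of_derive_lt0 (dphi a _) da.
  near (0 : R)^'+ => h.
  have h0 : 0 < h by near: h; exact: nbhs_right_gt.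
  have hb : h < b - a by near: h; exact: nbhs_right_lt.
  have : phi (a + h) < phi a by near: h; apply: da'; rewrite lexx ltW.
  apply/negP; rewrite -leNgt -ca; apply: cmin; rewrite in_itv/= ca; lra.
have cb' : c != b.
  apply/eqP => cb'.
  have dr : is_derive (0 : R) (1 : R) (fun x : R => phi (b - x)) (d b * - 1).
    apply: (@is_derive1_comp R phi (fun x : R => b - x) 0 (d b) (- 1)).
      by rewrite subr0; apply: dphi; rewrite lexx ltW.
    have [_ /(_ 0) dB] := primitive_onB (primitive_on_cst (- 1) 1 b)
      (primitive_on_id (- 1) 1).
    by rewrite -[- 1]sub0r; apply: dB; rewrite ltrN10 ltr01.
  have dr0 : d b * - 1 < 0 by lra.
  have db' := near_right_lt_of_derive_lt0 dr dr0.
  near (0 : R)^'+ => h.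
  have h0 : 0 < h by near: h; exact: nbhs_right_gt.
  have hb : h < b - a by near: h; exact: nbhs_right_lt.
  have : phi (b - (0 + h)) < phi (b - 0) by near: h; exact: db'.
  apply/negP; rewrite -leNgt subr0 add0r -cb'; apply: cmin; rewrite in_itv/= cb'; lra.
have acb : a < c < b by rewrite !lt_neqAle eq_sym ca ac cb' cb.
exists c => //.
have : is_derive c 1 phi 0.
  apply: (@derive1_at_min _ phi a b c (ltW ab)); rewrite ?in_itv//=.
    by move=> t tab; apply: dphi'; exact: subset_itv_oo_cc tab.
  by move=> t tab; apply: cmin; exact: subset_itv_oo_cc tab.
have [] := dphi c _; first by rewrite ac cb.
by move=> _ <- [].
Unshelve. all: by end_near. Qed.

Lemma darboux phi d (a b : R) : a < b ->
  (forall x, a <= x <= b -> is_derive x 1 phi (d x)) -> d a * d b < 0 ->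
  exists2 z, a < z < b & d z = 0.
Proof.
move=> ab dphi dab.
have [da|da|da] := ltgtP (d a) 0.
- apply: (darboux_lt ab dphi da); move: dab; rewrite nmulr_rlt0//.
- have dN x : a <= x <= b -> is_derive x 1 (- phi) (- d x).
    by move=> /dphi; exact: is_deriveN.
  have [||z zab /eqP] := darboux_lt ab dN.
  + by rewrite oppr_lt0.
  + by rewrite oppr_gt0; move: dab; rewrite pmulr_rlt0.
  + by rewrite oppr_eq0 => /eqP; exists z.
- by move: dab; rewrite da mul0r ltxx.
Qed.

(** Concavity of [x `^ q^-1], from the affine bound [conjugate_scale] taken at
    the mean of [x] and [y]. *)
Lemma powRD_le_mean p q x y : 0 < p -> 0 < q -> p^-1 + q^-1 = 1 ->
  0 <= x -> 0 <= y ->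
  x `^ q^-1 + y `^ q^-1 <= 2 `^ p^-1 * (x + y) `^ q^-1.
Proof.
move=> p0 q0 pq x0 y0; have [xy0|xy0] := eqVneq (x + y) 0.
  have -> : x = 0 by lra.
  have -> : y = 0 by lra.
  by rewrite addr0 powR0 ?invr_neq0 ?gt_eqF// addr0 mulr0.
pose m := (x + y) / 2.
have m0 : 0 < m by rewrite divr_gt0// lt_neqAle eq_sym xy0 addr_ge0.
have hx := conjugate_scale p0 q0 pq m0 x0.
have hy := conjugate_scale p0 q0 pq m0 y0.
apply: (le_trans (lerD hx hy)).
rewrite -mulrDr.
have -> : x / (q * m) + p^-1 + (y / (q * m) + p^-1) = 2.
  have -> : x / (q * m) + p^-1 + (y / (q * m) + p^-1) =
     (x + y) / (q * m) + 2 * p^-1 by ring.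
  have -> : x + y = 2 * m by rewrite /m; field.
  rewrite -mulf_div mulfV ?gt_eqF// mulr1 -mulrDr addrC pq; ring.
have pE : p^-1 = 1 - q^-1 by lra.
rewrite pE powRB; last by rewrite pnatr_eq0 implybT.
rewrite powRr1// /m powRM ?invr_ge0// ?addr_ge0// -[2^-1]powR_inv1// -powRrM mulN1r powRN.
by rewrite le_eqVlt; apply/orP; left; apply/eqP; ring.
Qed.

(** The pointwise heart of the proof. If [d y] and [d (1 - y)] have the same sign,
    their difference is at most the larger of the two, and generalized convexity
    between the endpoints [0] and [1] bounds both. If the signs are opposite,
    [d] has a zero [z] between the two points; convexity between [0] and [z], and
    between [z] and [1], then bounds each value by the contribution of a single
    endpoint, so that adding them costs only the factor [2 `^ p^-1]. *)
Lemma derivative_gap_le p q sigma phi d y :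
  0 < p -> 0 < q -> p^-1 + q^-1 = 1 -> 0 < sigma ->
  (forall x, 0 < x < 1 -> is_derive x 1 phi (d x)) ->
  (forall x y t, 0 <= x <= 1 -> 0 <= y <= 1 -> 0 <= t <= 1 ->
    `|d (t * x + (1 - t) * y)| `^ q <=
    t `^ sigma * `|d x| `^ q + (1 - t) `^ sigma * `|d y| `^ q) ->
  0 < y < 1 / 2 ->
  `|d y - d (1 - y)| <=
    2 `^ p^-1 * (`|d 0| `^ q + `|d 1| `^ q) `^ q^-1 * (1 - y) `^ (sigma / q).
Proof.
move=> p0 q0 pq s0 dphi conv /andP[y0 y1].
set A := `|d 0| `^ q; set B := `|d 1| `^ q.
have A0 : 0 <= A by exact: powR_ge0.
have B0 : 0 <= B by exact: powR_ge0.
have z01 : 0 <= (0 : R) <= 1 by rewrite lexx ler01.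
have o01 : 0 <= (1 : R) <= 1 by rewrite lexx ler01.
set W := (1 - y) `^ sigma.
have W0 : 0 <= W by exact: powR_ge0.
have yW : y `^ sigma <= W by apply: ge0_ler_powR; rewrite ?nnegrE; lra.
have root x C : 0 <= C -> `|d x| `^ q <= W * C ->
    `|d x| <= C `^ q^-1 * (1 - y) `^ (sigma / q).
  move=> C0 dC; have -> : `|d x| = (`|d x| `^ q) `^ q^-1.
    by rewrite -powRrM mulfV ?gt_eqF// powRr1.
  rewrite powRrM mulrC -powRM//; apply: ge0_ler_powR => //.
  - by rewrite invr_ge0 ltW.
  - by rewrite nnegrE powR_ge0.
  - by rewrite nnegrE mulr_ge0.
have two1 : 1 <= 2 `^ p^-1 :> R by apply: powR2_ge1; rewrite invr_ge0 ltW.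
have [same|opp] := leP 0 (d y * d (1 - y)).
  (* Equal signs. *)
  set bound := 2 `^ p^-1 * _ * _.
  have le_bound x : `|d x| `^ q <= W * (A + B) -> `|d x| <= bound.
    move=> /(root _ _ (addr_ge0 A0 B0)) /le_trans; apply; rewrite /bound -mulrA.
    by rewrite ler_peMl// mulr_ge0 ?powR_ge0.
  have by_ : `|d y| <= bound.
    apply: le_bound.
    have /(_ _)/le_trans := conv 1 0 y o01 z01; rewrite mulr1 mulr0 addr0.
    apply; first by lra.
    rewrite -/A -/B -/W mulrDr addrC lerD2l; exact: ler_wpM2r.
  have by1 : `|d (1 - y)| <= bound.
    apply: le_bound.
    have := conv 1 0 (1 - y) o01 z01; rewrite mulr1 mulr0 addr0 subKr.
    have h : 0 <= 1 - y <= 1 by lra.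
    move=> /(_ h)/le_trans; apply.
    rewrite -/A -/B -/W mulrDr addrC lerD2r; exact: ler_wpM2r.
  move: same by_ by1; have [dy|dy] := ger0P (d y); have [d1|d1] := ger0P (d (1 - y)).
  - by move=> _ h1 h2; rewrite ler_norml; lra.
  - rewrite nmulr_lge0// => ? h1 h2; rewrite ler_norml; lra.
  - rewrite nmulr_rge0// => ? h1 h2; rewrite ler_norml; lra.
  - by move=> _ h1 h2; rewrite ler_norml; lra.
(* Opposite signs: the convexity inequality is used with the zero z of d, where
   it has a vanishing term. *)
have yy : y < 1 - y by lra.
have dphi' x : y <= x <= 1 - y -> is_derive x 1 phi (d x) by move=> xy; apply: dphi; lra.
have [z /andP[yz z1y] dz] := darboux yy dphi' opp.
have zz : 0 <= z <= 1 by lra.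
have dz0 : `|d z| `^ q = 0 by rewrite dz normr0 powR0// gt_eqF.
have gy : `|d y| `^ q <= W * A.
  have z0 : 0 < z by lra.
  have t01 : 0 <= y / z <= 1 by rewrite divr_ge0 ?(ltW y0) ?(ltW z0)// ler_pdivrMr// mul1r ltW.
  have := conv z 0 (y / z) zz z01 t01.
  rewrite mulr0 addr0 divfK ?gt_eqF// dz0 mulr0 add0r => /le_trans; apply.
  apply: ler_wpM2r => //; apply: ge0_ler_powR; rewrite ?nnegrE ?(ltW s0)//; try lra.
  have : y <= y / z by rewrite ler_pdivlMr// ler_piMr; lra.
  lra.
have gy1 : `|d (1 - y)| `^ q <= W * B.
  have z0 : 0 < 1 - z by lra.
  have t01 : 0 <= y / (1 - z) <= 1.
    by rewrite divr_ge0 ?(ltW y0) ?(ltW z0)// ler_pdivrMr// mul1r; lra.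
  have := conv z 1 (y / (1 - z)) zz o01 t01.
  have -> : y / (1 - z) * z + (1 - y / (1 - z)) * 1 = 1 - y.
    by field; rewrite gt_eqF.
  rewrite dz0 mulr0 add0r => /le_trans; apply.
  apply: ler_wpM2r => //; apply: ge0_ler_powR; rewrite ?nnegrE ?(ltW s0)//; try lra.
  have : y <= y / (1 - z) by rewrite ler_pdivlMr// ler_piMr; lra.
  lra.
apply: (le_trans (ler_normB _ _)).
apply: (le_trans (lerD (root _ _ A0 gy) (root _ _ B0 gy1))).
rewrite -mulrDl; apply: ler_wpM2r; first exact: powR_ge0.
exact: powRD_le_mean.
Qed.

End derivative_gap.

(** * Reduction of Katugampola integrals to the unit interval *)

Section one_sided.
Context {R : realType}.
Implicit Types (a b : R) (f : R -> R).

Lemma diff_quotient_cvg (F : set_system R) (f : R -> R) (a : R) : Filter F ->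
  (\forall h \near F, h != 0) -> h @[h --> F] --> (0 : R) ->
  cvg (diff_quotient f a h @[h --> F]) -> f (a + h) @[h --> F] --> f a.
Proof.
move=> FF h_neq0 h0 /cvg_ex[/= l dl].
have : f a + h * diff_quotient f a h @[h --> F] --> f a + 0 * l.
  by apply: cvgD; [exact: cvg_cst|exact: cvgM].
rewrite mul0r addr0; apply: cvg_trans; apply: near_eq_cvg.
near=> h; rewrite /diff_quotient mulVKf ?subrKC//.
by near: h; exact: h_neq0.
Unshelve. all: by end_near. Qed.

(** Continuity at an endpoint comes from the one-sided derivative there. *)
Lemma derivable_cc_primitive a b f : a < b -> derivable_cc a b f ->
  primitive_on a b f (derive_cc a b f).
Proof.
move=> ab [df dfa dfb].
have is_df x : a < x < b -> is_derive x 1 f (derive_cc a b f x).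
  move=> /andP[ax xb]; rewrite /derive_cc (gt_eqF ax) (lt_eqF xb) derive1E.
  by apply/derivableP/df; rewrite in_itv/= ax.
split => //; apply/continuous_within_itvP => //; split.
- move=> x; rewrite in_itv/= => axb; apply: differentiable_continuous.
  by apply/derivable1_diffP; case: (is_df _ axb).
- apply/cvgrPdist_lt => e e0; apply/nbhs_right0P.
  have /cvgrPdist_lt : f (a + h) @[h --> 0^'+] --> f a.
    apply: diff_quotient_cvg dfa; last exact: cvg_at_right_filter.
    by near=> h; rewrite gt_eqF//; near: h; exact: nbhs_right_gt.
  exact.
- apply/cvgrPdist_lt => e e0; apply/nbhs_left0P.
  have : f (b + h) @[h --> 0^'-] --> f b.
    apply: diff_quotient_cvg dfb; last exact: cvg_at_left_filter.
    by near=> h; rewrite lt_eqF//; near: h; exact: nbhs_left_lt.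
  by move=> /cvg_at_leftNP; rewrite oppr0 => /cvgrPdist_lt; exact.
Unshelve. all: by end_near. Qed.

End one_sided.

Section substitution.
Context {R : realType}.
Implicit Types (alpha c e u v x t : R).
Local Notation mu := (@lebesgue_measure R).

(** Change of variable in a singular integral. The factor [e] is the sign of
    [dtheta]: the left-sided integral needs a decreasing substitution. *)
Lemma Rintegral_powR_substitution alpha c e u v (theta dtheta f : R -> R) :
  0 < alpha -> u < v -> primitive_on u v theta dtheta ->
  (forall x, u <= x <= v -> 0 <= theta x <= 1) ->
  (forall x, u < x < v -> 0 < theta x < 1) ->
  (forall x, u < x < v -> {for x, continuous dtheta}) ->
  (forall x, u < x < v -> `|dtheta x| = e * dtheta x) ->
  {within `[0, 1], continuous f} ->
  \int[mu]_(t in `[u, v]) (c * (theta t `^ (alpha - 1) * f (theta t) * dtheta t)) =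
  c * (\int[mu]_(t in `[0, theta v]) (t `^ (alpha - 1) * f t)
    - \int[mu]_(t in `[0, theta u]) (t `^ (alpha - 1) * f t)).
Proof.
move=> a0 uv ptheta thcc thoo cdth edth cf.
have cint x : 0 < x < 1 -> {for x, continuous (fun t => t `^ (alpha - 1) * f t)}.
  move=> /[dup] x01 /andP[x0 x1]; apply: cvgM; first exact: powR_continuous_pos.
  exact: (within_continuous_continuous ltr01 cf).
have pW : primitive_on 0 1 (fun x => \int[mu]_(t in `[0, x]) (t `^ (alpha - 1) * f t))
      (fun t => t `^ (alpha - 1) * f t).
  by apply: primitive_on_Rintegral => //; exact: powR_weight_integrable.
have pF := primitive_onZ c (primitive_on_comp thcc thoo pW ptheta).
have cg x : u < x < v -> {for x, continuous
    (fun t => c * (theta t `^ (alpha - 1) * f (theta t) * dtheta t))}.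
  move=> uxv; apply: cvgM; first exact: cvg_cst.
  apply: cvgM; last exact: cdth.
  apply: (@continuous_comp _ _ _ theta (fun t => t `^ (alpha - 1) * f t)).
    exact: primitive_on_continuous ptheta uxv.
  exact/cint/thoo.
rewrite (Rintegral_primitive (ltW uv) _ cg pF) ?mulrBr//.
have cnf : {within `[0, 1], continuous (fun x => `|f x|)}.
  by move=> x; apply: cvg_norm; exact: cf.
have [m _ fm] := EVT_max ler01 cnf.
have pG := primitive_onZ (`|c| * `|f m| / alpha * e)
  (primitive_on_comp thcc thoo (primitive_on_powR 1 (lexx 0) a0) ptheta).
apply: (integrable_dominated_by_derivative uv cg pG) => x uxv.
rewrite !normrM (edth _ uxv) (ger0_norm (powR_ge0 _ _)).
have -> : `|c| * `|f m| / alpha * e *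
    (alpha * theta x `^ (alpha - 1) * dtheta x) =
    (`|c| * theta x `^ (alpha - 1) * (e * dtheta x)) * `|f m|.
  by field; rewrite gt_eqF.
have -> : `|c| * (theta x `^ (alpha - 1) * `|f (theta x)| * (e * dtheta x)) =
    (`|c| * theta x `^ (alpha - 1) * (e * dtheta x)) * `|f (theta x)| by ring.
apply: ler_wpM2l; first by rewrite -edth// !mulr_ge0 ?powR_ge0.
by apply: fm; rewrite in_itv/=; have /andP[/ltW-> /ltW->] := thoo _ uxv.
Qed.

(** The substitutions [y = (t `^ rho - a) / (b - a)] and
    [y = (b - t `^ rho) / (b - a)] turn the right-sided and the left-sided integral
    into the two integrals of the defect; the remaining constant is
    [Gamma (alpha + 1) / Gamma alpha = alpha]. *)
Lemma katugampola_trapezoid alpha rho u v (psi : R -> R) :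
  0 < alpha -> 0 < rho -> 0 <= u -> u < v ->
  {within `[u `^ rho, v `^ rho], continuous psi} ->
  (psi (u `^ rho) + psi (v `^ rho)) / 2
     - rho `^ alpha * Gamma (alpha + 1)
         / (2 * (v `^ rho - u `^ rho) `^ alpha)
       * (katugampola_left rho alpha u (fun t => psi (t `^ rho)) v
          + katugampola_right rho alpha v (fun t => psi (t `^ rho)) u)
  = trapezoid_defect alpha
      (fun y => psi (u `^ rho + (v `^ rho - u `^ rho) * y)) / 2.
Proof.
move=> a0 rho0 u0 uv cpsi.
set a := u `^ rho in cpsi *; set b := v `^ rho in cpsi *.
have ab : a < b.
  by apply: gt0_ltr_powR; rewrite ?nnegrE// (le_trans u0 (ltW uv)).
pose L := b - a; rewrite -/L; have L0 : 0 < L by rewrite subr_gt0.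
pose phi y := psi (a + L * y).
have paff (c d : R) := primitive_onD (primitive_on_cst 0 1 c)
  (primitive_onZ d (primitive_on_id 0 1)).
have cphi : {within `[0, 1], continuous phi}.
  apply: (within_continuous_comp _ cpsi (paff a L).1) => y /=; rewrite !in_itv/=.
  move=> /andP[y0 y1]; rewrite lerDl mulr_ge0 ?(ltW L0)//=.
  by rewrite -lerBrDl -/L ler_piMr// ltW.
have cphi' : {within `[0, 1], continuous (fun y => phi (1 - y))}.
  apply: (within_continuous_comp _ cphi (primitive_on_onem 0 1).1) => y /=.
  by rewrite !in_itv/= => /andP[? ?]; apply/andP; split; lra.
have pX := primitive_on_powR v u0 rho0.
have xab x : u <= x <= v -> a <= x `^ rho <= b.
  move=> /andP[ux xv]; have x0 := le_trans u0 ux; have v0 := le_trans x0 xv.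
  by rewrite !ge0_ler_powR ?nnegrE// ltW.
have xab' x : u < x < v -> a < x `^ rho < b.
  move=> /andP[ux xv]; have x0 := le_lt_trans u0 ux; have v0 := lt_trans x0 xv.
  by rewrite !gt0_ltr_powR ?nnegrE ?(ltW x0) ?(ltW v0).
pose thr x := L^-1 * (x `^ rho - a); pose thl x := L^-1 * (b - x `^ rho).
have pr : primitive_on u v thr (fun x => L^-1 * (rho * x `^ (rho - 1))).
  have := primitive_onZ L^-1 (primitive_onB pX (primitive_on_cst u v a)).
  by apply: primitive_on_eq => x _; rewrite subr0.
have pl : primitive_on u v thl (fun x => L^-1 * - (rho * x `^ (rho - 1))).
  have := primitive_onZ L^-1 (primitive_onB (primitive_on_cst u v b) pX).
  by apply: primitive_on_eq => x _; rewrite sub0r.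
have Lth x : L * thr x = x `^ rho - a by rewrite /thr mulrA mulfV ?mul1r ?gt_eqF.
have Lthl x : L * thl x = b - x `^ rho by rewrite /thl mulrA mulfV ?mul1r ?gt_eqF.
have thlE x : thl x = 1 - thr x.
  by rewrite /thl /thr -[1](mulVf (lt0r_neq0 L0)) -mulrBr /L; congr (_ * _); ring.
have Li : 0 < L^-1 by rewrite invr_gt0.
have Li0 := ltW Li.
have thrcc x : u <= x <= v -> 0 <= thr x <= 1.
  move=> /xab/andP[ax xb]; rewrite /thr mulr_ge0 ?Li0 ?subr_ge0//=.
  by rewrite mulrC ler_pdivrMr// mul1r lerD2r.
have throo x : u < x < v -> 0 < thr x < 1.
  move=> /xab'/andP[ax xb]; rewrite /thr mulr_gt0 ?Li ?subr_gt0//=.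
  by rewrite mulrC ltr_pdivrMr// mul1r ltrD2r.
have thlcc x : u <= x <= v -> 0 <= thl x <= 1.
  by move=> /thrcc; rewrite thlE => /andP[? ?]; apply/andP; split; lra.
have thloo x : u < x < v -> 0 < thl x < 1.
  by move=> /throo; rewrite thlE => /andP[? ?]; apply/andP; split; lra.
have cX x : u < x < v -> {for x, continuous (fun x => x `^ (rho - 1))}.
  by move=> /andP[ux _]; apply: powR_continuous_pos; exact: le_lt_trans ux.
have thru : thr u = 0 by rewrite /thr subrr mulr0.
have thrv : thr v = 1 by rewrite /thr mulVf// gt_eqF.
have thlu : thl u = 1 by rewrite thlE thru subr0.
have thlv : thl v = 0 by rewrite thlE thrv subrr.
pose W (f : R -> R) := \int[mu]_(t in `[0, 1]) (t `^ (alpha - 1) * f t).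
have L1 : L `^ (alpha - 1) * L = L `^ alpha by rewrite mulrC mulr_powRB1// ltW.
have Ir : \int[mu]_(t in `[u, v])
   ((t `^ rho - a) `^ (alpha - 1) * t `^ (rho - 1) * psi (t `^ rho)) =
   L `^ alpha / rho * W phi.
  have := @Rintegral_powR_substitution alpha (L `^ alpha / rho) 1 u v thr _ phi
    a0 uv pr thrcc throo.
  rewrite thru thrv set_itv1 Rintegral_set1 subr0 -/(W phi) => <-//.
  - apply: eq_Rintegral => t; rewrite inE/= in_itv/= => /thrcc/andP[t0 t1].
    rewrite -Lth powRM ?(ltW L0)// /phi Lth subrKC -L1.
    by field; rewrite !gt_eqF.
  - move=> x /cX cx; apply: cvgM; first exact: cvg_cst.
    by apply: cvgM; [exact: cvg_cst|exact: cx].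
  - move=> x _; rewrite mul1r ger0_norm//.
    by rewrite !mulr_ge0 ?powR_ge0 ?invr_ge0 ?(ltW rho0) ?(ltW L0).
have Il : \int[mu]_(t in `[u, v])
   ((b - t `^ rho) `^ (alpha - 1) * t `^ (rho - 1) * psi (t `^ rho)) =
   L `^ alpha / rho * W (fun y => phi (1 - y)).
  have := @Rintegral_powR_substitution alpha (- (L `^ alpha / rho)) (- 1) u v thl _
    (fun y => phi (1 - y)) a0 uv pl thlcc thloo.
  rewrite thlu thlv set_itv1 Rintegral_set1 sub0r mulrNN -/(W _) => <-//.
  - apply: eq_Rintegral => t; rewrite inE/= in_itv/= => /thlcc/andP[t0 t1].
    have -> : 1 - thl t = thr t by rewrite thlE subKr.
    rewrite -Lthl powRM ?(ltW L0)// /phi Lth subrKC -L1.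
    by field; rewrite !gt_eqF.
  - move=> x /cX cx; apply: cvgM; first exact: cvg_cst.
    by apply: cvgN; apply: cvgM; [exact: cvg_cst|exact: cx].
  - move=> x _; rewrite mulN1r ler0_norm// mulrN oppr_le0.
    by rewrite !mulr_ge0 ?powR_ge0 ?invr_ge0 ?(ltW rho0) ?(ltW L0).
have -> : katugampola_left rho alpha u (fun t => psi (t `^ rho)) v =
    rho `^ (1 - alpha) / Gamma alpha * (L `^ alpha / rho * W (fun y => phi (1 - y))).
  by congr (_ * _); exact: Il.
have -> : katugampola_right rho alpha v (fun t => psi (t `^ rho)) u =
    rho `^ (1 - alpha) / Gamma alpha * (L `^ alpha / rho * W phi).
  by congr (_ * _); exact: Ir.
rewrite (GammaS a0).
rewrite /trapezoid_defect -/(W phi) -/(W (fun y => phi (1 - y))).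
rewrite mulr0 addr0 mulr1 subrKC.
have rho1 : rho `^ (1 - alpha) = rho / rho `^ alpha.
  rewrite powRB; last by apply/implyP => _; rewrite gt_eqF.
  by rewrite powRr1// ltW.
rewrite rho1.
have G0 : Gamma alpha != 0 by rewrite gt_eqF// Gamma_gt0.
have La0 : L `^ alpha != 0 by rewrite gt_eqF// powR_gt0.
have ra0 : rho `^ alpha != 0 by rewrite gt_eqF// powR_gt0.
by field; rewrite gt_eqF//= ra0 La0 G0.
Qed.

End substitution.

(** * Comparison of the constants and conclusion *)

(** Raised to the power [p], and since [p / q = p - 1], the claim becomes
    [M * K `^ (p - 1) <= rho / (p * (rho - 1) + 1)], where
    [M = 2 * (1 - 2 `^ (- alpha)) / (alpha + 1)] and where
    [K = (alpha + 1) / (alpha + 2)] bounds the ratio of the second moment to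
    [rho] times the bracket on the right. As a function of [rho] the right-hand
    side stays above its limit [1 / p], so that [weight_constant_le] suffices. *)
Lemma constant_le (R : realType) (alpha sigma rho p q : R) :
  0 < alpha -> 0 < sigma -> sigma <= 1 -> 0 < rho -> 1 < p -> 0 < q ->
  p^-1 + q^-1 = 1 -> 0 < p * (rho - 1) + 1 ->
  2 `^ p^-1 * (((1 - 2 `^ (- alpha)) / (alpha + 1)) `^ p^-1 *
    ((1 - 2 `^ (- (alpha + sigma))) / (alpha + sigma + 1)) `^ q^-1) <=
  rho * (1 / (p * (rho - 1) + 1)) `^ p^-1 *
    (beta_rho rho (sigma + 1) (alpha + 1) / rho
      + 1 / (rho * (sigma + alpha + 1))) `^ q^-1.
Proof.
move=> a0 s0 s1 rho0 p1 q0 pq r0.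
have p0 : 0 < p by lra.
have pi0 : 0 <= p^-1 by rewrite invr_ge0 ltW.
have qi0 : 0 <= q^-1 by rewrite invr_ge0 ltW.
have a10 : 0 < alpha + 1 by lra.
have a20 : 0 < alpha + 2 by lra.
have as0 : 0 < alpha + sigma + 1 by lra.
have hbeta := le_beta_rho rho0 a0 s0 s1.
set beta := beta_rho _ _ _ in hbeta *.
pose K := (alpha + 1) / (alpha + 2); have K0 : 0 < K by rewrite divr_gt0.
pose G := beta + (alpha + sigma + 1)^-1.
have G0 : 0 <= G.
  rewrite addr_ge0 ?invr_ge0 ?(ltW as0)//; apply: le_trans hbeta.
  by rewrite invr_ge0 mulr_ge0 ?(ltW a10) ?(ltW as0).
set m := (1 - 2 `^ (- alpha)) / (alpha + 1).
set J := (1 - 2 `^ (- (alpha + sigma))) / _.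
have pow2_le1 x : 0 <= x -> 0 <= 1 - 2 `^ (- x) :> R.
  by move=> x0; rewrite subr_ge0 powRN invf_le1 ?powR_gt0// powR2_ge1.
have m0 : 0 <= m by rewrite divr_ge0 ?pow2_le1 ?(ltW a0) ?(ltW a10).
have m20 : 0 <= 2 * m by exact: mulr_ge0.
have J0 : 0 <= J by rewrite divr_ge0 ?pow2_le1 ?(ltW as0)//; lra.
have JKG : J <= K * G.
  apply: (@le_trans _ _ (alpha + sigma + 1)^-1).
    by rewrite /J ler_piMl ?invr_ge0 ?(ltW as0)// gerBl powR_ge0.
  have -> : (alpha + sigma + 1)^-1 = K * (((alpha + 1) * (alpha + sigma + 1))^-1
      + (alpha + sigma + 1)^-1).
    by rewrite /K; field; rewrite !gt_eqF.
  by apply: ler_wpM2l; [exact: ltW|rewrite lerD2r].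
have -> : beta / rho + 1 / (rho * (sigma + alpha + 1)) = G / rho.
  by rewrite /G (addrC sigma); field; rewrite !gt_eqF.
have rhoE : rho = rho `^ p^-1 * rho `^ q^-1.
  by rewrite -powRD ?pq ?powRr1 ?(ltW rho0)// oner_eq0.
have -> : rho * (1 / (p * (rho - 1) + 1)) `^ p^-1 * (G / rho) `^ q^-1 =
    (rho / (p * (rho - 1) + 1)) `^ p^-1 * G `^ q^-1.
  rewrite [in LHS]div1r !powRM ?invr_ge0 ?(ltW rho0) ?(ltW r0)//.
  have rq0 : rho `^ q^-1 != 0 by rewrite gt_eqF// powR_gt0.
  have -> : (rho^-1) `^ q^-1 = (rho `^ q^-1)^-1.
    by rewrite -[rho^-1]powR_inv1 ?(ltW rho0)// -powRrM mulN1r powRN.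
  by rewrite {1}rhoE; field.
apply: (@le_trans _ _ ((2 * m * K `^ (p - 1)) `^ p^-1 * G `^ q^-1)).
  rewrite mulrA -powRM// [in leRHS]powRM ?m20 ?powR_ge0//.
  rewrite -[X in _ <= X]mulrA; apply: ler_wpM2l; first exact: powR_ge0.
  have -> : (K `^ (p - 1)) `^ p^-1 = K `^ q^-1.
    rewrite -powRrM; congr (_ `^ _).
    by rewrite mulrBl mulfV ?gt_eqF// mul1r; lra.
  rewrite -powRM ?(ltW K0)//; apply: ge0_ler_powR => //.
  by rewrite nnegrE mulr_ge0// ltW.
apply: ler_wpM2r; first exact: powR_ge0.
have rr0 : 0 <= rho / (p * (rho - 1) + 1) by rewrite divr_ge0 ?(ltW rho0) ?(ltW r0).
apply: ge0_ler_powR => //.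
  by rewrite nnegrE mulr_ge0 ?powR_ge0.
apply: (@le_trans _ _ p^-1).
  rewrite -[p^-1]mul1r ler_pdivlMr//.
  by have := weight_constant_le a0 p1; rewrite -/K /m; lra.
rewrite ler_pdivlMr// mulrC ler_pdivrMr//; lra.
Qed.

Unset Implicit Arguments.
Set Strict Implicit.

Theorem theorem4 (R : realType) (alpha rho s u v p q : R) (psi : R -> R)
    (alpha_gt0 : 0 < alpha) (rho_gt0 : 0 < rho) (s_gt0 : 0 < s) (s_le1 : s <= 1)
    (u_ge0 : 0 <= u) (u_lt_v : u < v)
    (q_gt1 : 1 < q) (pq_conj : p^-1 + q^-1 = 1)
    (rhs_defined : 0 < p * (rho - 1) + 1)
    (psi_diff : derivable_cc (u `^ rho) (v `^ rho) psi)
    (dpsi_L1 : (@lebesgue_measure R).-integrable `[u `^ rho, v `^ rho]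
       (EFin \o derive_cc (u `^ rho) (v `^ rho) psi))
    (dpsi_convex : gen_s_convex alpha s `[u `^ rho, v `^ rho]
       (fun x => `|derive_cc (u `^ rho) (v `^ rho) psi x| `^ q)) :
  `| (psi (u `^ rho) + psi (v `^ rho)) / 2
     - rho `^ alpha * Gamma (alpha + 1)
         / (2 * (v `^ rho - u `^ rho) `^ alpha)
       * (katugampola_left rho alpha u (fun t => psi (t `^ rho)) v
          + katugampola_right rho alpha v (fun t => psi (t `^ rho)) u) |
  <= rho * (v `^ rho - u `^ rho) / 2
     * (1 / (p * (rho - 1) + 1)) `^ (1 / p)
     * (beta_rho rho (alpha * s + 1) (alpha + 1) / rho
        + 1 / (rho * (alpha * s + alpha + 1))) `^ (1 / q)
     * (`|derive_cc (u `^ rho) (v `^ rho) psi (u `^ rho)| `^ q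
        + `|derive_cc (u `^ rho) (v `^ rho) psi (v `^ rho)| `^ q) `^ (1 / q).
Proof.
have ab : u `^ rho < v `^ rho.
  by apply: gt0_ltr_powR; rewrite ?nnegrE// (le_trans u_ge0 (ltW u_lt_v)).
have q0 : 0 < q by lra.
have [p0 p1] : 0 < p /\ 1 < p.
  have qi1 : q^-1 < 1 by rewrite invf_lt1.
  have qi0 : 0 < q^-1 by rewrite invr_gt0.
  have p0 : 0 < p by rewrite -invr_gt0; lra.
  by split=> //; rewrite -(invf_lt1 p0); lra.
have sigma0 : 0 < alpha * s by rewrite mulr_gt0.
have ppsi := derivable_cc_primitive ab psi_diff.
rewrite (katugampola_trapezoid alpha_gt0 rho_gt0 u_ge0 u_lt_v ppsi.1) !div1r.
set a := u `^ rho in ab ppsi dpsi_convex *.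
set b := v `^ rho in ab ppsi dpsi_convex *.
pose L := b - a; rewrite -/L; have L0 : 0 < L by rewrite subr_gt0.
pose h y := a + L * y; pose d y := derive_cc a b psi (h y).
have h0 : h 0 = a by rewrite /h mulr0 addr0.
have h1 : h 1 = b by rewrite /h mulr1 subrKC.
have hcc x : 0 <= x <= 1 -> a <= h x <= b.
  move=> /andP[x0 x1]; rewrite lerDl mulr_ge0 ?(ltW L0)//=.
  by rewrite -lerBrDl -/L ler_piMr// ltW.
have hoo x : 0 < x < 1 -> a < h x < b.
  move=> /andP[x0 x1]; rewrite ltrDl mulr_gt0//=.
  by rewrite -ltrBrDl -/L gtr_pMr.
have ph := primitive_onD (primitive_on_cst 0 1 a) (primitive_onZ L (primitive_on_id 0 1)).
have pphi : primitive_on 0 1 (fun y => psi (h y)) (fun y => L * d y).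
  have := primitive_on_comp hcc hoo ppsi ph.
  by apply: primitive_on_eq => x _; rewrite add0r mulr1 mulrC.
have pphiL : primitive_on 0 1 (fun y => L^-1 * psi (h y)) d.
  by apply: primitive_on_eq (primitive_onZ L^-1 pphi) => x _; rewrite mulKf// gt_eqF.
have conv x y t : 0 <= x <= 1 -> 0 <= y <= 1 -> 0 <= t <= 1 ->
    `|d (t * x + (1 - t) * y)| `^ q <=
    t `^ (alpha * s) * `|d x| `^ q + (1 - t) `^ (alpha * s) * `|d y| `^ q.
  move=> x01 y01 t01; rewrite /d.
  have -> : h (t * x + (1 - t) * y) = t * h x + (1 - t) * h y by rewrite /h; ring.
  by apply: dpsi_convex => //; rewrite /= in_itv/=; exact: hcc.
have gap y : 0 < y < 1 / 2 -> `|L * d y - L * d (1 - y)| <=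
    L * (2 `^ p^-1 * (`|d 0| `^ q + `|d 1| `^ q) `^ q^-1) * (1 - y) `^ ((alpha * s) / q).
  move=> y01; rewrite -mulrBr normrM gtr0_norm// -[leRHS]mulrA ler_pM2l//.
  exact: (derivative_gap_le p0 q0 pq_conj sigma0 pphiL.2 conv y01).
have D0 : 0 <= (`|d 0| `^ q + `|d 1| `^ q) `^ q^-1 by exact: powR_ge0.
have c0 : 0 <= L * (2 `^ p^-1 * (`|d 0| `^ q + `|d 1| `^ q) `^ q^-1).
  by rewrite !mulr_ge0 ?powR_ge0// ltW.
have := trapezoid_defect_power_le alpha_gt0 sigma0 p0 q0 pq_conj c0 pphi gap.
have -> : derive_cc a b psi a = d 0 by rewrite /d h0.
have -> : derive_cc a b psi b = d 1 by rewrite /d h1.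
move=> le_T; rewrite normrM [X in _ * X]ger0_norm ?invr_ge0//.
rewrite ler_pdivrMr//; apply: (le_trans le_T).
have [s1|s1] := leP (alpha * s) 1.
  have := constant_le alpha_gt0 sigma0 s1 rho_gt0 p1 q0 pq_conj rhs_defined.
  move=> /(ler_wpM2l (mulr_ge0 (ltW L0) D0)); rewrite !div1r => le_c.
  set lhs := (X in X <= _) in le_c; set rhs := (X in _ <= X) in le_c.
  have -> : L * (2 `^ p^-1 * (`|d 0| `^ q + `|d 1| `^ q) `^ q^-1) *
     (((1 - 2 `^ (- alpha)) / (alpha + 1)) `^ p^-1 *
      ((1 - 2 `^ (- (alpha + alpha * s))) / (alpha + alpha * s + 1)) `^ q^-1) = lhs.
    by rewrite /lhs; ring.
  apply: (le_trans le_c).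
  by rewrite le_eqVlt; apply/orP; left; apply/eqP; rewrite /rhs; field.
(* For alpha * s > 1 the convexity inequality at x = y with t = 1/2 forces the
   derivative to vanish. *)
have half_lt : 2^-1 `^ (alpha * s) < 2^-1 :> R.
  rewrite -[2^-1]powR_inv1// -powRrM mulN1r powRN powR_inv1// ltf_pV2 ?posrE ?powR_gt0//.
  have ln2_gt0 : 0 < ln 2 :> R by rewrite ln_gt0// ltr1n.
  rewrite -[ltLHS]lnK ?posrE// /powR gt_eqF// ltr_expR.
  by rewrite -[ltLHS]mul1r ltr_pM2r.
have dz x : 0 <= x <= 1 -> `|d x| `^ q = 0.
  move=> x01; have h01 : 0 <= (2^-1 : R) <= 1 by lra.
  have := conv x x 2^-1 x01 x01 h01.
  rewrite -mulrDl subrKC mul1r (_ : 1 - 2^-1 = 2^-1 :> R); last by lra.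
  have := powR_ge0 `|d x| q; move: (_ `^ q) => g g0 le_g.
  by apply/eqP; rewrite eq_le g0 andbT; nra.
have -> : `|d 0| `^ q = 0 by apply: dz; rewrite lexx ler01.
have -> : `|d 1| `^ q = 0 by apply: dz; rewrite lexx ler01.
by rewrite addr0 powR0 ?invr_neq0 ?gt_eqF// !mulr0 !mul0r.
Qed.
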